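(* Let $S_1,\ldots,S_N:\mathbb{R}^d\to\mathbb{R}^d$ be contracting similarities, let $r_i\in(0,1)$ be the similarity ratio of $S_i$, and let $(p_1,\ldots,p_N)$ be a probability vector with all $p_i>0$. Let $\mu$ be the unique Borel probability measure on $\mathbb{R}^d$ with $\mu=\sum_i p_i\,\mu\circ S_i^{-1}$. Assume that the list $(S_1,\ldots,S_N)$ satisfies the Open Set Condition. For a closed interval $I\subseteq\mathbb{R}$ let $$\zeta_I^{\mathrm{sim}}(s)=\sum_{\mathbf{i}\in\Sigma^*,\ \frac{\log p_{\mathbf{i}}}{\log r_{\mathbf{i}}}\in I} r_{\mathbf{i}}^{\,s}$$ for those complex numbers $s$ for which the series converges absolutely. If $$\overset{\circ}{I}\cap\Big(\min_i\tfrac{\log p_i}{\log r_i},\ \max_i\tfrac{\log p_i}{\log r_i}\Big)\neq\varnothing,$$ where $\overset{\circ}{I}$ is the interior of $I$, then $$\sigma_{\mathrm{ab}}\big(\zeta_I^{\mathrm{sim}}\big)=\sup_{\alpha\in I}f_\mu(\alpha)=\sup_{\alpha\in I}f_\mu^{\mathrm c}(\alpha),$$ where $\sigma_{\mathrm{ab}}(\zeta_I^{\mathrm{sim}})$ is the abscissa of convergence of $\zeta_I^{\mathrm{sim}}$.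
   Context: $\Sigma^*=\{i_1\ldots i_n : n\in\mathbb{N},\ i_j\in\{1,\ldots,N\}\}$ is the set of all finite strings; for $\mathbf{i}=i_1\ldots i_n\in\Sigma^*$ write $r_{\mathbf{i}}=r_{i_1}\cdots r_{i_n}$ and $p_{\mathbf{i}}=p_{i_1}\cdots p_{i_n}$. Open Set Condition (OSC): there is a non-empty bounded open set $O$ with $S_iO\subseteq O$ for all $i$ and $S_iO\cap S_jO=\varnothing$ for all $i\ne j$. For a zeta-function $\zeta(s)=\sum_{\mathbf{i}}a_{\mathbf{i}}^s$ with $a_{\mathbf{i}}>0$, $\sigma_{\mathrm{ab}}(\zeta)=\inf\{t\in\mathbb{R}: \sum_{\mathbf{i}}a_{\mathbf{i}}^t \text{ converges absolutely}\}\in[-\infty,\infty]$. Multifractal spectrum: with $K=\operatorname{supp}\mu$, $f_\mu(\alpha)=\dim_{\mathrm H}\{x\in K:\lim_{r\searrow0}\frac{\log\mu(B(x,r))}{\log r}=\alpha\}$, where $\dim_{\mathrm H}$ is Hausdorff dimension, $B(x,r)$ is the ball with center $x$ and radius $r$, and by convention $\dim_{\mathrm H}\varnothing=-\infty$. Coarse multifractal spectrum: for $r,\delta>0$ let $N_{\mu,\delta}(\alpha;r)$ be the supremum of $|I|$ over all finite families of balls $(B(x_i,\delta))_{i\in I}$ with $x_i\in K$ for all $i$, $B(x_i,\delta)\cap B(x_j,\delta)=\varnothing$ for $i\ne j$, and $\alpha-r\le\frac{\log\mu(B(x_i,\delta))}{\log\delta}\le\alpha+r$ for all $i$. Put $f_\mu^{\mathrm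 c}(\alpha;r)=\liminf_{\delta\searrow0}\frac{\log N_{\mu,\delta}(\alpha;r)}{-\log\delta}$ (with $\log0=-\infty$) and $f_\mu^{\mathrm c}(\alpha)=\lim_{r\searrow0}f_\mu^{\mathrm c}(\alpha;r)$. *)

(* Defs.v *)
From HB Require Import structures.
From mathcomp Require Import all_boot all_order all_algebra.
From mathcomp Require Import all_classical all_reals all_analysis.

Set Implicit Arguments.
Unset Strict Implicit.
Unset Printing Implicit Defensive.

Import Order.TTheory GRing.Theory Num.Theory.
Import numFieldNormedType.Exports.

Local Open Scope classical_set_scope.
Local Open Scope ring_scope.

Section Euclidean.
Context {R : realType} {d : nat}.
Implicit Types (x y : 'rV[R]_d) (A : set 'rV[R]_d).

(* The norm the library puts on 'rV[R]_d is the sup norm. It induces the same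
   topology and the same bounded sets, so the library's [open] and
   [bounded_set] are used, but distances, balls and diameters below are
   Euclidean. *)
Definition edist x y : R := Num.sqrt (\sum_(j < d) (x 0 j - y 0 j) ^+ 2).

(* "The ball with center x and radius r" is read as the closed ball. *)
Definition eball x (r : R) : set 'rV[R]_d := [set y | edist x y <= r].

Definition ediam A : \bar R :=
  ereal_sup [set (edist z.1 z.2)%:E | z in A `*` A].

(* [ediam A] to the power [s], the empty set contributing 0 also when s = 0 *)
Definition diam_pow (s : R) A : \bar R :=
  if A == set0 then 0%E else poweR (ediam A) s.

Definition delta_cover (delta : R) A (U : nat -> set 'rV[R]_d) : Prop :=
  A `<=` \bigcup_k U k /\ forall k, (ediam (U k) <= delta%:E)%E.

Definition hausdorff_premeasure (s delta : R) A : \bar R :=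
  ereal_inf [set (\sum_(0 <= k <oo) diam_pow s (U k))%E |
    U in [set U | delta_cover delta A U]].

Definition hausdorff_measure (s : R) A : \bar R :=
  ereal_sup [set hausdorff_premeasure s delta A |
    delta in [set delta : R | 0 < delta]].

Definition hausdorff_dim A : \bar R :=
  if A == set0 then -oo%E
  else ereal_inf [set s%:E |
         s in [set s : R | 0 <= s /\ hausdorff_measure s A = 0%E]].

Definition similarity (r : R) (S : 'rV[R]_d -> 'rV[R]_d) : Prop :=
  forall x y, edist (S x) (S y) = r * edist x y.

End Euclidean.

Definition borelRd (R : realType) (d : nat) :=
  g_sigma_algebraType (@open 'rV[R]_d).

Definition open_set_condition (R : realType) (d N : nat)
    (S : 'I_N -> 'rV[R]_d.+1 -> 'rV[R]_d.+1) : Prop :=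
  exists O : set 'rV[R]_d.+1,
    [/\ O !=set0, bounded_set O, open O,
        forall i, S i @` O `<=` O &
        forall i j, i != j -> (S i @` O) `&` (S j @` O) = set0].

Section Spectra.
Context {R : realType} {d : nat}.
Variable mu : probability (borelRd R d) R.
Implicit Types (x : 'rV[R]_d) (alpha r delta : R).

Definition self_similar_measure (N : nat) (p : 'I_N -> R)
    (S : 'I_N -> 'rV[R]_d -> 'rV[R]_d) : Prop :=
  forall A : set (borelRd R d), measurable A ->
    mu A = (\sum_(i < N) (p i)%:E * mu (S i @^-1` A))%E.

Definition measure_support : set 'rV[R]_d :=
  [set x | forall U : set 'rV[R]_d, open U -> U x -> (0 < mu U)%E].

(* For x in the support the measure of the ball is positive, so the total
   logarithm [ln] is not evaluated outside its domain. *)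
Definition log_ratio x delta : R := ln (fine (mu (eball x delta))) / ln delta.

Definition multifractal_spectrum alpha : \bar R :=
  hausdorff_dim [set x | measure_support x /\
    log_ratio x r @[r --> 0^'+] --> alpha].

Definition packing_family alpha r delta (n : nat) (x : 'I_n -> 'rV[R]_d)
    : Prop :=
  [/\ forall i, measure_support (x i),
      forall i j, i != j -> eball (x i) delta `&` eball (x j) delta = set0 &
      forall i, alpha - r <= log_ratio (x i) delta <= alpha + r].

Definition packing_number alpha r delta : \bar R :=
  ereal_sup [set (n%:R : R)%:E | n in
    [set n : nat | exists x : 'I_n -> 'rV[R]_d, packing_family alpha r delta x]].

(* [lne 0 = -oo] *)
Definition coarse_spectrum_at alpha r : \bar R :=
  limf_einf
    (fun delta => (lne (packing_number alpha r delta) * ((- ln delta)^-1)%:E)%E)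
    (0 : R)^'+.

(* [coarse_spectrum_at alpha] is nondecreasing, so the limit exists. *)
Definition coarse_spectrum alpha : \bar R :=
  lim (coarse_spectrum_at alpha r @[r --> (0 : R)^'+]).

End Spectra.

(* For the zeta-function s |-> \sum_(w in D) a w ^ s with all a w > 0. Only real
   exponents matter for the abscissa of absolute convergence. *)
Definition abscissa_abs (R : realType) (T : choiceType) (D : set T)
    (a : T -> R) : \bar R :=
  ereal_inf [set t%:E | t in
    [set t : R | summable D (fun w => (a w `^ t)%:E)]].

Section Words.
Context {R : realType} {N : nat}.

Definition word_prod (r : 'I_N -> R) (w : seq 'I_N) : R := \prod_(i <- w) r i.

(* The empty word is left out: its quotient of logarithms would be 0 / 0. *)
Definition zeta_words (r p : 'I_N -> R) (I : set R) : set (seq 'I_N) :=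
  [set w | w != [::] /\ I (ln (word_prod p w) / ln (word_prod r w))].

Definition abscissa_zeta_sim (r p : 'I_N -> R) (I : set R) : \bar R :=
  abscissa_abs (zeta_words r p I) (word_prod r).

End Words.

Definition min_over (R : realType) (N : nat) (a : 'I_N.+1 -> R) : R :=
  \big[Num.min/a ord0]_i a i.
Definition max_over (R : realType) (N : nat) (a : 'I_N.+1 -> R) : R :=
  \big[Num.max/a ord0]_i a i.

(* Main.v *)
Require Import Defs.
From HB Require Import structures.
From mathcomp Require Import all_boot all_order all_algebra.
From mathcomp Require Import all_classical all_reals all_analysis.
From mathcomp Require Import ring lra zify.
Import Order.TTheory GRing.Theory Num.Theory.
Import numFieldNormedType.Exports.
Local Open Scope classical_set_scope.
Local Open Scope ring_scope.
Import Defs.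

(** The number [alpha] is the exponent of a word [w] when
    [ln (word_prod p w) = alpha * ln (word_prod r w)].  Writing sigma for the
    abscissa, f for the Hausdorff spectrum and g for the coarse one, the proof
    establishes sigma <= sup f <= sup g <= sigma, the suprema being over [I], by
    counting words.

    The abscissa is at most sup f ([abscissa_le_sup_spectrum]).  If the zeta
    function diverges at [s > t], then words can be grouped by how often each
    letter occurs, and since the sum of [word_prod r w `^ (s - t)] over all these
    classes is a product of geometric series, some class contains at least
    [word_prod r w `^ - t] words ([exists_large_composition_class]).  All words of
    a class have the same ratio and the same weight, so they generate a
    homogeneous self-similar set of dimension at least [t].  All its points have
    the exponent of the generating words as local dimension, provided that balls
    around them do not catch heavy cylinders of other branches.  This is achieved
    with an idea of Schief: append to each generating word a word with the largest
    possible number of neighbours at its scale ([exists_separating_word]).  A few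
    copies of a letter of larger or smaller exponent compensate for the
    perturbation and keep the exponent in [I] ([exists_steering_letter]); such a
    letter exists because the interior of [I] meets the open range of the
    exponents.  The dimension estimate is a mass distribution argument on codes
    ([exists_avoiding_digits], [homogeneous_spectrum_ge]).

    The inequality f <= g is the comparison of Hausdorff dimension with box
    dimension ([multifractal_le_coarse]): doubling the balls of a maximal packing
    covers the points whose exponents have settled at a given scale.

    The coarse spectrum is at most sigma ([coarse_le_abscissa]).  Each ball of a
    packing with exponents near [alpha] contains a cylinder of comparable size, of
    exponent at least about [alpha], and by the open set condition also meets one of
    exponent at most about [alpha] ([packing_words]).  Concatenating [m] words of
    either kind and switching once from one kind to the other at the right place
    produces words of exponent near [alpha], almost as many as [m]-tuples of balls
    ([mixed_words_bound]).  A packing at one small scale that is too large would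
    thus make the zeta function diverge ([packing_count_le]). *)

(** * Euclidean distance and balls *)

Section EuclideanDistance.
Context {R : realType} {d : nat}.
Implicit Types x y z : 'rV[R]_d.

Definition dot x y : R := \sum_(j < d) x 0 j * y 0 j.

Lemma dotC x y : dot x y = dot y x.
Proof. by apply: eq_bigr => j _; rewrite mulrC. Qed.

Lemma dotDl x y z : dot (x + y) z = dot x z + dot y z.
Proof. by rewrite -big_split; apply: eq_bigr => j _; rewrite mxE mulrDl. Qed.

Lemma dotNl x y : dot (- x) y = - dot x y.
Proof. by rewrite -sumrN; apply: eq_bigr => j _; rewrite mxE mulNr. Qed.

Lemma dotZl a x y : dot (a *: x) y = a * dot x y.
Proof. by rewrite mulr_sumr; apply: eq_bigr => j _; rewrite mxE mulrA. Qed.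

Lemma dot0l x : dot 0 x = 0.
Proof. by rewrite -(subrr (x : 'rV[R]_d)) dotDl dotNl subrr. Qed.

Lemma dot_ge0 x : 0 <= dot x x.
Proof. by apply: sumr_ge0 => j _; rewrite -expr2 sqr_ge0. Qed.

Lemma dotBB x y : dot (x - y) (x - y) = dot x x - 2 * dot x y + dot y y.
Proof.
by rewrite !(dotDl, dotNl, dotC _ (_ - _)) (dotC y x); ring.
Qed.

Lemma cauchy_schwarz x y : dot x y ^+ 2 <= dot x x * dot y y.
Proof.
have Hx := dot_ge0 x; have Hy := dot_ge0 y.
(* The component of [x] orthogonal to [y], scaled to avoid a division. *)
have := dot_ge0 (dot y y *: x - dot x y *: y).
rewrite dotBB !dotZl !(dotC _ (_ *: _)) !dotZl => H.
have {}H : 0 <= dot y y * (dot x x * dot y y - dot x y ^+ 2).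
  by rewrite (_ : _ * _ = dot y y * (dot y y * dot x x) -
      2 * (dot y y * (dot x y * dot y x)) + dot x y * (dot x y * dot y y)) //;
    rewrite (dotC y x); ring.
have := Hy; rewrite le_eqVlt => /predU1P[y0|y_gt0]; last first.
  by rewrite pmulr_rge0// subr_ge0 in H.
suff -> : y = 0.
  by rewrite (dotC x) !dot0l expr0n mulr0.
apply/rowP => j; rewrite mxE; apply/eqP; rewrite -sqrf_eq0.
rewrite expr2; move/esym/eqP: y0; rewrite psumr_eq0.
  by move/allP => /(_ j (mem_index_enum _)).
by move=> i _; rewrite -expr2 sqr_ge0.
Qed.

Lemma edistE x y : edist x y = Num.sqrt (dot (x - y) (x - y)).
Proof.
by congr Num.sqrt; apply: eq_bigr => j _; rewrite !mxE expr2.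
Qed.

Lemma sqr_edist x y : edist x y ^+ 2 = dot (x - y) (x - y).
Proof. by rewrite edistE sqr_sqrtr ?dot_ge0. Qed.

Lemma edist_ge0 x y : 0 <= edist x y.
Proof. exact: sqrtr_ge0. Qed.

Lemma edistxx x : edist x x = 0.
Proof. by rewrite edistE subrr dot0l sqrtr0. Qed.

Lemma edistC x y : edist x y = edist y x.
Proof.
by congr Num.sqrt; apply: eq_bigr => j _; rewrite -sqrrN opprB.
Qed.

Lemma edist_triangle y x z : edist x z <= edist x y + edist y z.
Proof.
rewrite -(@ler_pXn2r _ 2) ?nnegrE ?addr_ge0 ?edist_ge0//.
rewrite sqrrD !sqr_edist.
have -> : x - z = (x - y) - (z - y) by rewrite opprB addrA subrK.
rewrite dotBB.
have -> : dot (y - z) (y - z) = dot (z - y) (z - y).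
  by rewrite -(opprB z y) dotNl dotC dotNl opprK.
rewrite lerD2r lerD2l -[X in _ <= X]mulr_natl -mulrN ler_wpM2l//.
rewrite (le_trans (ler_norm _))// normrN -ler_sqr ?nnegrE ?mulr_ge0 ?edist_ge0//.
rewrite real_normK ?num_real// exprMn (edistC y z) !sqr_edist.
exact: cauchy_schwarz.
Qed.

Lemma coord_le_edist x y j : `|x 0 j - y 0 j| <= edist x y.
Proof.
rewrite -ler_sqr ?nnegrE ?edist_ge0// sqr_edist real_normK ?num_real//.
rewrite /dot (bigD1 j)//= !mxE -expr2 lerDl.
by apply: sumr_ge0 => i _; rewrite -expr2 sqr_ge0.
Qed.

Lemma edist_le_coord x y (h : R) : 0 <= h ->
  (forall j, `|x 0 j - y 0 j| <= h) -> edist x y <= d%:R * h.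
Proof.
move=> h0 H.
rewrite -ler_sqr ?nnegrE ?edist_ge0 ?mulr_ge0 ?ler0n// sqr_edist /dot.
apply: (@le_trans _ _ (\sum_(j < d) h ^+ 2)).
  apply: ler_sum => j _; rewrite !mxE -expr2 -(real_normK (num_real _)).
  by rewrite ler_sqr ?nnegrE.
rewrite sumr_const card_ord exprMn -[X in X <= _]mulr_natl ler_wpM2r ?sqr_ge0//.
by rewrite -natrX ler_nat; case: (d) => // n; rewrite expnS expn1 leq_pmulr.
Qed.

Lemma edist_eq0 x y : edist x y = 0 -> x = y.
Proof.
move=> xy0; apply/rowP => j; apply/eqP; rewrite -subr_eq0 -normr_le0 -xy0.
exact: coord_le_edist.
Qed.

Lemma edist_ball x y (e : R) : 0 < e -> ball x e y -> edist x y <= d%:R * e.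
Proof.
move=> e0 [_ H]; apply: edist_le_coord; first exact: ltW.
by move=> j; apply/ltW; exact: H.
Qed.

Lemma ball_edist x y (e : R) : edist x y < e -> ball x e y.
Proof.
move=> H; split; first by apply: le_lt_trans H; exact: edist_ge0.
move=> i j; rewrite ord1; apply: le_lt_trans H; exact: coord_le_edist.
Qed.

Lemma nbhs_eball x e : 0 < e -> nbhs x (eball x e).
Proof.
move=> e0; apply/nbhs_ballP; exists (e / d.+1%:R) => /=; first by rewrite divr_gt0.
move=> y /edist_ball; rewrite divr_gt0 // => /(_ isT) H.
rewrite /eball /= (le_trans H)// mulrC mulrAC -mulrA ler_piMr ?(ltW e0)//.
by rewrite ler_pdivrMr// mul1r ler_nat.
Qed.

Lemma eball_sub_open (O : set 'rV[R]_d) x : open O -> O x ->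
  exists2 e : R, 0 < e & eball x e `<=` O.
Proof.
rewrite openE => + Ox => /(_ _ Ox) /nbhs_ballP[e /= e0 H].
exists (e / 2); first by rewrite divr_gt0.
move=> y Hy; apply: H; apply: ball_edist; apply: le_lt_trans Hy _; lra.
Qed.

Lemma closed_eball x e : closed (eball x e).
Proof.
rewrite closedE => y Hy; rewrite /eball /= leNgt; apply/negP => xy.
apply: Hy; have de : 0 < (edist x y - e) / 2 by lra.
suff : eball y ((edist x y - e) / 2) `<=` ~` eball x e.
  by move=> sub; exact: (filterS sub (nbhs_eball y _ de)).
rewrite /eball => z /= yz xz.
have := edist_triangle z x y; rewrite (edistC z); lra.
Qed.

Lemma open_sub_eball x e : 0 < e ->
  exists V : set 'rV[R]_d, [/\ open V, V x & V `<=` eball x e].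
Proof.
move=> e0; exists (interior (eball x e)); split.
- exact: open_interior.
- exact: nbhs_eball.
- exact: interior_subset.
Qed.

(** Completeness in the form needed for coded points: the centres form a Cauchy
    sequence because every later centre lies in every earlier ball. *)
Lemma eball_nested (u : nat -> 'rV[R]_d) (e : nat -> R) :
  (forall n, eball (u n.+1) (e n.+1) `<=` eball (u n) (e n)) ->
  (forall n, 0 <= e n) -> e @ \oo --> 0 ->
  exists x, forall n, eball (u n) (e n) x.
Proof.
move=> sub e0 cve.
have le_sub n k : eball (u (n + k)%N) (e (n + k)%N) `<=` eball (u n) (e n).
  by elim: k => [|k IH]; rewrite ?addn0// addnS; exact: subset_trans IH.
have uB n k : edist (u n) (u (n + k)%N) <= e n.
  by apply: (le_sub n k (u (n + k)%N)); rewrite /eball /= edistxx.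
have cu : cauchy (u @ \oo).
  apply: cauchy_exP => eps eps0.
  have [n _ Hn] := cvgr_lt _ cve _ eps0.
  exists (u n); exists n => // k /= nk; apply: ball_edist.
  by rewrite -(subnKC nk) (le_lt_trans (uB _ _))// Hn/=.
have cv : cvgn u by exact: cauchy_cvg.
exists (lim (u @ \oo)) => n.
apply: (@closed_cvg _ _ \oo _ u _ (closed_eball (u n) (e n)) _ _ cv).
by exists n => // k /= nk; rewrite -(subnKC nk); exact: uB.
Qed.

End EuclideanDistance.

(** * Similarities and grid packing *)

Section Similarity.
Context {R : realType} {d : nat}.
Implicit Types x y z : 'rV[R]_d.

(** A similarity [S] of the whole space is onto.  After removing the translation
    and the ratio it preserves inner products, so the images of the standard
    basis are orthonormal and form an invertible matrix; a vector is then
    determined by its inner products with these images, which can be prescribed. *)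
Lemma similarity_surj (r : R) (S : 'rV[R]_d -> 'rV[R]_d) : 0 < r ->
  similarity r S -> forall y, exists x, S x = y.
Proof.
move=> r0 simS y; pose T x := r^-1 *: (S x - S 0).
have TB x z : dot (T x - T z) (T x - T z) = dot (x - z) (x - z).
  rewrite -!sqr_edist.
  suff -> : edist (T x) (T z) = edist x z by [].
  have -> : edist (T x) (T z) = r^-1 * edist (S x) (S z).
    rewrite !edistE /T -scalerBr opprB addrA subrK dotZl dotC dotZl.
    rewrite mulrA -expr2 sqrtrM ?sqr_ge0// sqrtr_sqr gtr0_norm ?invr_gt0//.
  by rewrite simS mulrA mulVf ?mul1r ?gt_eqF.
have T0 : T 0 = 0 by rewrite /T subrr scaler0.
(* Polarization. *)
have Tdot x z : dot (T x) (T z) = dot x z.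
  have nn u : dot (T u) (T u) = dot u u by have := TB u 0; rewrite T0 !subr0.
  by have := TB x z; rewrite !dotBB !nn => H; lra.
pose e j : 'rV[R]_d := delta_mx 0 j.
have dot_e x j : dot x (e j) = x 0 j.
  rewrite /dot (bigD1 j)//= big1 ?addr0 ?mxE ?eqxx ?mulr1//.
  by move=> i ij; rewrite mxE (negbTE ij) andbF mulr0.
pose M := \matrix_i T (e i).
have MT x i : (x *m M^T) 0 i = dot x (T (e i)).
  by rewrite !mxE; apply: eq_bigr => j _; rewrite !mxE.
have MM : M *m M^T = 1%:M.
  apply/matrixP => i j; have := MT (T (e i)) j.
  rewrite Tdot dot_e !mxE eqxx eq_sym /= => <-.
  by apply: eq_bigr => k _; rewrite !mxE.
have Minj x z : x *m M^T = z *m M^T -> x = z.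
  move=> H; have : x *m M^T *m M = z *m M^T *m M by rewrite H.
  by rewrite -!mulmxA (mulmx1C MM) !mulmx1.
pose x := r^-1 *: ((y - S 0) *m M^T).
have Tx : T x = r^-1 *: (y - S 0).
  by apply: Minj; apply/rowP => i; rewrite MT Tdot dot_e -scalemxAl.
exists x; move: Tx; rewrite /T => /(congr1 (fun v => r *: v)).
by rewrite !scalerA divff ?gt_eqF// !scale1r => /addIr.
Qed.

(** Points at mutual distance more than [sep * b] lie in different cells of a grid
    of mesh proportional to [b], and a ball of radius [C * b] meets a number of
    cells that does not depend on [b]. *)
Lemma separated_in_ball_bounded (sep C : R) : 0 < sep -> 0 <= C ->
  exists M : nat, forall (T : eqType) (c : T -> 'rV[R]_d) (x : 'rV[R]_d) (b : R)
    (L : seq T), 0 < b -> uniq L ->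
    {in L &, forall u v, u != v -> sep * b < edist (c u) (c v)} ->
    {in L, forall u, edist (c u) x <= C * b} -> (size L <= M)%N.
Proof.
move=> sep0 C0; pose h := sep / d.+1%:R.
have h0 : 0 < h by rewrite divr_gt0.
pose K := (Num.truncn (2 * C / h)).+1.
exists (#|{: {ffun 'I_d -> 'I_K}}|) => T c x b L b0 uL sepL inL.
have [->//|L0] := eqVneq L [::].
(* Shifted by [C * b], all coordinates relative to [x] are nonnegative. *)
pose t u j := Num.truncn ((c u 0 j - x 0 j + C * b) / (h * b)).
have hb0 : 0 < h * b by rewrite mulr_gt0.
have coord u j : u \in L -> 0 <= (c u 0 j - x 0 j + C * b) / (h * b) <= 2 * C / h.
  move=> uin; have := le_trans (coord_le_edist (c u) x j) (inL u uin).
  rewrite ler_norml => /andP[l1 l2]; apply/andP; split.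
    by rewrite divr_ge0 ?(ltW hb0)//; lra.
  rewrite ler_pdivrMr// (_ : 2 * C / h * (h * b) = 2 * (C * b)); first lra.
  by field; rewrite gt_eqF.
have tK u j : u \in L -> (t u j < K)%N.
  move=> uin; rewrite ltnS /t; have /andP[c1 c2] := coord u j uin.
  by rewrite le_truncn.
pose f u : {ffun 'I_d -> 'I_K} := [ffun j => inord (t u j)].
suff finj : {in L &, injective f}.
  by rewrite -(size_map f) -(card_uniqP _) ?map_inj_in_uniq// max_card.
move=> u v uL' vL' fuv; apply/eqP; apply: contraT => uv.
have := sepL u v uL' vL' uv; rewrite ltNge => /negP[].
apply: (@le_trans _ _ (d%:R * (h * b))).
  apply: edist_le_coord; first exact: ltW.
  move=> j; have tuv : t u j = t v j.
    have := congr1 (fun g : {ffun _} => nat_of_ord (g j)) fuv.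
    by rewrite !ffunE !inordK ?tK.
  have /andP[u1 _] := coord u j uL'; have /andP[v1 _] := coord v j vL'.
  have /andP[] := truncn_itv u1; have /andP[] := truncn_itv v1.
  rewrite -/(t u j) -/(t v j) tuv.
  rewrite !ler_pdivlMr// !ltr_pdivrMr// -natr1 mulrDl mul1r ler_norml.
  by set w := _ * (h * b); set w' := C * b; clearbody w w' => *; lra.
rewrite mulrA ler_pM2r// /h mulrCA ler_piMr ?(ltW sep0)// ler_pdivrMr// mul1r ler_nat//.
Qed.

End Similarity.

(** * Words, ratios and stopping words *)

Lemma prod_between01_le {R : realType} (n : nat) (a : 'I_n -> R) i :
  (forall j, 0 < a j < 1) -> 0 < \prod_j a j <= a i.
Proof.
move=> a01; rewrite prodr_gt0 => [|j _]; last by have /andP[] := a01 j.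
rewrite (bigD1 i)//= ger_pMr; last by have /andP[] := a01 i.
by apply: prodr_ile1 => j _; have /andP[/ltW-> /ltW->] := a01 j.
Qed.

Section WordProducts.
Context {R : realType} {N : nat}.
Implicit Types (u v w : seq 'I_N.+1) (a : 'I_N.+1 -> R).

Lemma word_prod_nil a : word_prod a [::] = 1.
Proof. exact: big_nil. Qed.

Lemma word_prod_cons a i w : word_prod a (i :: w) = a i * word_prod a w.
Proof. exact: big_cons. Qed.

Lemma word_prod_cat a u v : word_prod a (u ++ v) = word_prod a u * word_prod a v.
Proof. exact: big_cat. Qed.

Lemma word_prod_rcons a w i : word_prod a (rcons w i) = word_prod a w * a i.
Proof. by rewrite -cats1 word_prod_cat word_prod_cons word_prod_nil mulr1. Qed.

Lemma word_prod_gt0 a w : (forall i, 0 < a i) -> 0 < word_prod a w.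
Proof. by move=> a0; apply: prodr_gt0 => i _. Qed.

Lemma word_prod_le1 a w : (forall i, 0 < a i < 1) -> word_prod a w <= 1.
Proof. by move=> a01; apply: prodr_ile1 => i _; have /andP[/ltW-> /ltW->] := a01 i. Qed.

End WordProducts.

Section StoppingWords.
Context {R : realType} {N : nat} {r : 'I_N.+1 -> R}.
Context (r01 : forall i, 0 < r i < 1).
Implicit Types (u v w : seq 'I_N.+1) (b : R).
Local Notation rw := (word_prod r).

Let r_gt0 i : 0 < r i. Proof. by have /andP[] := r01 i. Qed.
Let rw_gt0 w : 0 < rw w. Proof. exact: word_prod_gt0. Qed.

(** Ratios decrease along a branch, so testing the longest proper prefix is enough
    to say that the branch is cut at [u] for the first time; the empty word, having
    no proper prefix, stops as soon as [1 <= b]. *)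
Definition stops b u : Prop :=
  rw u <= b /\ forall x i, u = rcons x i -> b < rw x.

(** Explicit bounds for the ratios: a product of numbers in ]0, 1[ is at most each
    of its factors, applied to the [r i] and to the [1 - r i]. *)
Definition rmin : R := \prod_i r i.
Definition rmax : R := 1 - \prod_i (1 - r i).

Lemma rmin_gt0 : 0 < rmin.
Proof. by have /andP[] := prod_between01_le _ _ ord0 r01. Qed.

Lemma rmin_le i : rmin <= r i.
Proof. by have /andP[] := prod_between01_le _ _ i r01. Qed.

Lemma rmax_ge i : r i <= rmax.
Proof.
have h j : 0 < 1 - r j < 1 by have /andP[h1 h2] := r01 j; apply/andP; lra.
by have /andP[_] := prod_between01_le _ _ i h; rewrite /rmax; lra.
Qed.

Lemma rmax_lt1 : rmax < 1.
Proof.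
have h j : 0 < 1 - r j < 1 by have /andP[h1 h2] := r01 j; apply/andP; lra.
by have /andP[+ _] := prod_between01_le _ _ ord0 h; rewrite /rmax; lra.
Qed.

Lemma rmax_ge0 : 0 <= rmax.
Proof. exact: le_trans (ltW (r_gt0 ord0)) (rmax_ge _). Qed.

Lemma word_prod_rcons_lt w i : rw (rcons w i) < rw w.
Proof. by rewrite word_prod_rcons gtr_pMr//; have /andP[] := r01 i. Qed.

(** If [v] properly extended [u], its longest proper prefix would still extend
    [u] and so have ratio at most [b]. *)
Lemma stops_prefix b u v : stops b u -> stops b v -> prefix u v -> u = v.
Proof.
move=> [ub _] [_ vb] /prefixP[s]; case: (lastP s) => [|s' i] vE.
  by rewrite vE cats0.
have := vb (u ++ s') i; rewrite -rcons_cat in vE; move=> /(_ vE).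
rewrite word_prod_cat => h; have := lt_le_trans h.
move=> /(_ (rw u)); rewrite ler_piMr ?(ltW (rw_gt0 _)) ?word_prod_le1// => /(_ isT).
by rewrite ltNge ub.
Qed.

(** Stopping is self-similar.  The bound [b <= 1] matters for the empty word only:
    it stops just when [b = 1], and then [w] stops at its own ratio. *)
Lemma stops_cat b w u : b <= 1 -> stops b u -> stops (rw w * b) (w ++ u).
Proof.
move=> b1 [ub uP]; split; first by rewrite word_prod_cat ler_pM2l.
move=> x i; case: (lastP u) ub uP => [|u' j] ub uP.
  rewrite word_prod_nil in ub; have -> : b = 1 by lra.
  by rewrite cats0 mulr1 => ->; exact: word_prod_rcons_lt.
rewrite -rcons_cat => /rcons_inj[<- _].
by rewrite word_prod_cat ltr_pM2l//; apply: uP (erefl _).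
Qed.

Lemma stops_lb b u : 0 < b -> b <= 1 -> stops b u -> rmin * b <= rw u.
Proof.
move=> b0 b1 [ub uP]; case: (lastP u) ub uP => [|u' j] ub uP.
  rewrite word_prod_nil; apply: le_trans b1; rewrite ger_pMl//.
  by apply: le_trans (rmin_le ord0) _; apply/ltW; have /andP[] := r01 ord0.
rewrite word_prod_rcons mulrC ler_pM ?(ltW b0) ?(ltW rmin_gt0) ?rmin_le//.
by apply/ltW; apply: uP.
Qed.

(** Cutting every branch of the tree of words as soon as its ratio is at most
    [b]; the fuel [n] suffices once [rmax ^+ n <= b]. *)
Fixpoint stopseq (n : nat) b : seq (seq 'I_N.+1) :=
  if n is n'.+1 then
    if 1 <= b then [:: [::]]
    else [seq i :: u | i <- enum 'I_N.+1, u <- stopseq n' (b / r i)]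
  else [:: [::]].

Lemma stopseq_uniq n b : uniq (stopseq n b).
Proof.
elim: n b => [//|n IH] b /=; case: ifP => // _.
apply: allpairs_uniq_dep; first exact: enum_uniq.
- by move=> i _; exact: IH.
- by move=> [i u] [j v] _ _ /= [-> ->].
Qed.

Lemma stopseq_stops n b u : 0 < b -> rmax ^+ n <= b -> u \in stopseq n b ->
  stops b u.
Proof.
elim: n b u => [|n IH] b u b0 /=.
  rewrite expr0 => b1; rewrite inE => /eqP->; split; first by rewrite word_prod_nil.
  by move=> x i; case: x.
move=> nb; case: ifPn => [b1|b1].
  rewrite inE => /eqP->; split; first by rewrite word_prod_nil.
  by move=> x i; case: x.
move=> /allpairsPdep[i [u' [_ u'in ->]]].
have [] := IH _ _ _ _ u'in; rewrite ?divr_gt0//.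
  rewrite ler_pdivlMr//; apply: le_trans nb; rewrite exprSr ler_wpM2l ?exprn_ge0 ?rmax_ge0//.
  exact: rmax_ge.
rewrite ler_pdivlMr// => ub uP; split; first by rewrite word_prod_cons mulrC.
move=> x j; case: x => [|k x] /= [].
  by rewrite word_prod_nil ltNge.
move=> <- u'E; have := uP _ _ u'E; rewrite ltr_pdivrMr//.
by rewrite word_prod_cons mulrC.
Qed.

Lemma stopseq_fuel b : 0 < b -> exists n, rmax ^+ n <= b.
Proof.
move=> b0; have cv : geometric 1 rmax n @[n --> \oo] --> (0 : R).
  by apply: cvg_geometric; rewrite ger0_norm ?rmax_ge0 ?rmax_lt1.
have [n _ H] := cvgr_le _ cv _ b0.
by exists n; have := H n (leqnn n); rewrite /= /geometric /= mul1r.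
Qed.

End StoppingWords.
Arguments stops {R N} r b u.
Arguments stopseq {R N} r n b.
Arguments rmin {R N} r.
Arguments rmax {R N} r.

(** * Cylinders of the iterated function system *)

Section WordMaps.
Context {R : realType} {d N : nat}.
Context {S : 'I_N.+1 -> 'rV[R]_d.+1 -> 'rV[R]_d.+1} {r : 'I_N.+1 -> R}.
Context (r01 : forall i, 0 < r i < 1).
Context (S_sim : forall i, similarity (r i) (S i)).
Implicit Types (u v w : seq 'I_N.+1) (x y z : 'rV[R]_d.+1) (b : R).
Local Notation rw := (word_prod r).

Let r_gt0 i : 0 < r i. Proof. by have /andP[] := r01 i. Qed.
Let rw_gt0 w : 0 < rw w. Proof. exact: word_prod_gt0. Qed.

Fixpoint word_map w x := if w is i :: w' then S i (word_map w' x) else x.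

Lemma word_map_cat u v x : word_map (u ++ v) x = word_map u (word_map v x).
Proof. by elim: u => //= i u ->. Qed.

Lemma word_map_sim w : similarity (rw w) (word_map w).
Proof.
elim: w => [|i w IH] x y /=; first by rewrite word_prod_nil mul1r.
by rewrite S_sim IH word_prod_cons mulrA.
Qed.

Lemma word_map_inj w : injective (word_map w).
Proof.
move=> x y xy; apply: edist_eq0; have := word_map_sim w x y.
rewrite xy edistxx => /esym/eqP; rewrite mulf_eq0 gt_eqF//= => /eqP//.
Qed.

(** Images of the open set under incomparable words are separated at the first
    letter in which the words differ. *)
Lemma word_map_disjoint (O : set 'rV[R]_d.+1) :
  (forall i, S i @` O `<=` O) ->
  (forall i j, i != j -> (S i @` O) `&` (S j @` O) = set0) ->
  forall u v x y, O x -> O y -> word_map u x = word_map v y ->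
    prefix u v \/ prefix v u.
Proof.
move=> SO Odisj; have wO w x : O x -> O (word_map w x).
  by elim: w => //= i w IH Ox; apply: (SO i); exists (word_map w x) => //; exact: IH.
elim=> [|i u IH] [|j v] x y Ox Oy /=; [by left|by left|by right|].
have [<-|ij] := eqVneq i j.
  by move=> /(word_map_inj [:: i]) /(IH _ _ _ Ox Oy).
move=> E; have : ((S i @` O) `&` (S j @` O)) (S i (word_map u x)).
  split; first by exists (word_map u x) => //; exact: wO.
  by rewrite E; exists (word_map v y) => //; exact: wO.
by rewrite Odisj.
Qed.

(** The images of the open set are disjoint and of comparable size, so only
    boundedly many of them fit into a region of that size. *)
Lemma osc_bounded_overlap (c0 C : R) : open_set_condition S ->
  0 < c0 -> 0 <= C ->
  exists M : nat, forall b x (L : seq (seq 'I_N.+1)), 0 < b -> uniq L ->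
    {in L &, forall u v, prefix u v -> u = v} ->
    {in L, forall u, c0 * b <= rw u <= b} ->
    {in L, forall u, edist (word_map u 0) x <= C * b} ->
    (size L <= M)%N.
Proof.
move=> [U [[a Ua] _ openU SU Udisj]] c00 C0.
have [e e0 eU] := eball_sub_open _ _ openU Ua.
have C'0 : 0 <= edist a 0 + C by rewrite addr_ge0 ?edist_ge0.
have [M HM] := separated_in_ball_bounded (d := d.+1) (e * c0) _ (mulr_gt0 e0 c00) C'0.
exists M => b x L b0 uL anti sz near_x.
apply: (HM _ (fun u => word_map u a) x b L b0 uL) => [u v uL' vL' uv|u uL']; last first.
  have := edist_triangle (word_map u 0) (word_map u a) x.
  have := near_x _ uL'; rewrite word_map_sim mulrDl.
  have /andP[_ h2] := sz u uL'.
  have : rw u * edist a 0 <= edist a 0 * b by rewrite mulrC ler_wpM2l ?edist_ge0.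
  lra.
rewrite ltNge; apply/negP => close.
have [y yE] := similarity_surj _ _ (rw_gt0 u) (word_map_sim u) (word_map v a).
have Uy : U y.
  apply: eU; rewrite /eball /= -(ler_pM2l (rw_gt0 u)) -word_map_sim yE.
  apply: le_trans close _; rewrite -mulrA mulrC ler_wpM2r ?(ltW e0)//.
  by have /andP[] := sz u uL'.
have [] := word_map_disjoint _ SU Udisj u v y a Uy Ua yE => pre.
  by move: uv; rewrite (anti _ _ uL' vL' pre) eqxx.
by move: uv; rewrite (anti _ _ vL' uL' pre) eqxx.
Qed.

Section Cylinders.
Context {Q : R} (Q_gt0 : 0 < Q) (Q_inv : forall i, edist (S i 0) 0 + r i * Q <= Q).

(** The image of the invariant ball under [word_map u], written as a ball so that
    it is visibly closed and membership is a single inequality. *)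
Definition cyl u : set 'rV[R]_d.+1 := eball (word_map u 0) (rw u * Q).

Lemma word_map_cyl u y : eball 0 Q y -> cyl u (word_map u y).
Proof. by move=> Qy; rewrite /cyl /eball /= word_map_sim ler_pM2l. Qed.

Lemma edist_word_map0 u : edist (word_map u 0) 0 + rw u * Q <= Q.
Proof.
elim: u => [|i u IH] /=; first by rewrite edistxx word_prod_nil add0r mul1r.
apply: le_trans (Q_inv i); rewrite word_prod_cons.
have := edist_triangle (S i 0) (S i (word_map u 0)) 0; rewrite S_sim.
have : r i * (edist (word_map u 0) 0 + rw u * Q) <= r i * Q by rewrite ler_pM2l.
rewrite mulrDr mulrA; lra.
Qed.

Lemma cyl_cat u v : cyl (u ++ v) `<=` cyl u.
Proof.
move=> x; rewrite /cyl /eball /= word_map_cat word_prod_cat.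
have := edist_triangle (word_map u (word_map v 0)) (word_map u 0) x.
rewrite word_map_sim (edistC 0).
have : rw u * (edist (word_map v 0) 0 + rw v * Q) <= rw u * Q.
  by rewrite ler_pM2l//; exact: edist_word_map0.
rewrite mulrDr mulrA; lra.
Qed.

Lemma cyl_diam u x y : cyl u x -> cyl u y -> edist x y <= 2 * Q * rw u.
Proof.
rewrite /cyl /eball /= => ux uy; have := edist_triangle (word_map u 0) x y.
rewrite (edistC x (word_map u 0)); set e := rw u * Q in ux uy.
have -> : 2 * Q * rw u = 2 * e by rewrite /e; ring.
lra.
Qed.

Definition neighbour C v u : Prop :=
  stops r (rw v) u /\ edist (word_map u 0) (word_map v 0) <= C * rw v.

Lemma neighbour_cat C w v u : neighbour C v u -> neighbour C (w ++ v) (w ++ u).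
Proof.
move=> [su nu]; split; rewrite word_prod_cat.
  by apply: stops_cat => //; exact: word_prod_le1.
by rewrite !word_map_cat word_map_sim mulrCA ler_pM2l.
Qed.

(** Schief's argument: among all words choose one, [v], with the largest number of
    neighbours, that is, of words of comparable ratio whose images are close at
    that scale.  Prefixing with [w] turns the neighbours of [v] into as many
    neighbours of [w ++ v], so [w ++ v] has no others and all of them extend [w]. *)
Lemma exists_maximal_neighbourhood C : open_set_condition S -> 0 <= C ->
  exists (v : seq 'I_N.+1) (M : nat), forall w L, uniq L ->
    {in L, forall u, neighbour C (w ++ v) u} ->
    (size L <= M)%N /\ {in L, forall u, prefix w u}.
Proof.
move=> osc C0.
have [M0 HM0] := osc_bounded_overlap _ _ osc (rmin_gt0 r01) C0.
have bnd v L : uniq L -> {in L, forall u, neighbour C v u} -> (size L <= M0)%N.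
  move=> uL nL; apply: (HM0 (rw v) (word_map v 0)) => //.
  - move=> u u' /nL[su _] /nL[su' _]; exact: (stops_prefix r01 _ _ _ su su').
  - move=> u /nL[[ub uP] _]; rewrite ub andbT.
    by apply: stops_lb => //; exact: word_prod_le1.
  - by move=> u /nL[].
(* [P n] holds when some word has [n] distinct neighbours. *)
pose P n := `[< exists v L, [/\ uniq L, {in L, forall u, neighbour C v u} &
  size L = n] >].
have P0 : exists n, P n by exists 0%N; apply/asboolP; exists [::], [::].
have Pb n : P n -> (n <= M0)%N.
  by move=> /asboolP[v [L [uL nL <-]]]; exact: bnd nL.
case: (ex_maxnP P0 Pb) => M /asboolP[v [L0 [uL0 nL0 sL0]]] Mmax.
exists v, M => w L uL nL; split.
  by apply: Mmax; apply/asboolP; exists (w ++ v), L.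
move=> u uL'.
pose wL0 := [seq w ++ u | u <- L0].
have [/mapP[u' _ ->]|uN] := boolP (u \in wL0); first exact: prefix_prefix.
have : P (M.+1); last by move=> /Mmax; rewrite ltnn.
apply/asboolP; exists (w ++ v), (u :: wL0); split.
- rewrite cons_uniq uN map_inj_uniq// => a b /eqP; rewrite eqseq_cat// => /andP[_ /eqP//].
- move=> a; rewrite inE => /orP[/eqP->|/mapP[u' u'in ->]]; first exact: nL.
  by apply: neighbour_cat; exact: nL0.
- by rewrite /= size_map sL0.
Qed.

End Cylinders.
End WordMaps.
Arguments word_map {R d N} S w x.
Arguments cyl {R d N} S r Q u.
Arguments neighbour {R d N} S r C v u.

(** * Mass of balls under a self-similar measure *)

Section BorelSets.
Context {R : realType} {d : nat}.

Lemma closed_measurable (A : set 'rV[R]_d) :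
  closed A -> measurable (A : set (borelRd R d)).
Proof.
move=> cA; rewrite -(setCK A); apply: measurableC.
by apply: sub_sigma_algebra; apply: closed_openC.
Qed.

Lemma similarity_closed_preimage (r : R) (S : 'rV[R]_d -> 'rV[R]_d)
    (A : set 'rV[R]_d) :
  0 < r -> similarity r S -> closed A -> closed (S @^-1` A).
Proof.
move=> r0 simS; apply: closed_comp => x _ B.
rewrite nbhs_simpl => /= nB.
have [e e0 eB] := eball_sub_open _ _ (open_interior B) nB.
have er : 0 < e / r by rewrite divr_gt0.
apply: filterS (nbhs_eball x _ er) => y /= xy; apply: (@interior_subset _ B).
apply: eB; rewrite /eball /= simS mulrC -ler_pdivlMr//.
Qed.

End BorelSets.

Section SelfSimilarMeasure.
Context {R : realType} {d N : nat}.
Context {S : 'I_N.+1 -> 'rV[R]_d.+1 -> 'rV[R]_d.+1} {r p : 'I_N.+1 -> R}.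
Context (r01 : forall i, 0 < r i < 1).
Context (S_sim : forall i, similarity (r i) (S i)).
Context (p_gt0 : forall i, 0 < p i) (p_sum : \sum_i p i = 1).
Context {mu : probability (borelRd R d.+1) R}.
Context (mu_ss : self_similar_measure mu p S).
Implicit Types (u v w : seq 'I_N.+1) (x y z : 'rV[R]_d.+1) (A : set 'rV[R]_d.+1).
Local Notation rw := (word_prod r).
Local Notation pw := (word_prod p).

Let r_gt0 i : 0 < r i. Proof. by have /andP[] := r01 i. Qed.
Let rw_gt0 w : 0 < rw w. Proof. exact: word_prod_gt0. Qed.
Let pw_gt0 w : 0 < pw w. Proof. exact: word_prod_gt0. Qed.

Lemma prob_le1 i : p i <= 1.
Proof. by rewrite -p_sum (bigD1 i)//= lerDl sumr_ge0// => j _; exact: ltW. Qed.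

Lemma closed_word_preimage w A : closed A -> closed (word_map S w @^-1` A).
Proof. exact: similarity_closed_preimage (rw_gt0 w) (word_map_sim S_sim w). Qed.

Lemma mu_self_similar_closed A : closed A ->
  mu A = (\sum_i (p i)%:E * mu (S i @^-1` A))%E.
Proof. by move=> cA; apply: mu_ss; exact: closed_measurable. Qed.

Lemma mu_word_preimage_le w A : closed A ->
  ((pw w)%:E * mu (word_map S w @^-1` A) <= mu A)%E.
Proof.
elim: w A => [|i w IH] A cA; first by rewrite word_prod_nil mul1e.
have cSA := similarity_closed_preimage _ _ _ (r_gt0 i) (S_sim i) cA.
rewrite word_prod_cons EFinM -muleA.
apply: (@le_trans _ _ ((p i)%:E * mu (S i @^-1` A))%E).
  by apply: lee_wpmul2l; [rewrite lee_fin ltW|exact: (IH _ cSA)].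
rewrite (mu_self_similar_closed _ cA) (bigD1 i)//= leeDl//.
by apply: sume_ge0 => j _; rewrite mule_ge0// lee_fin ltW.
Qed.

(** Self-similarity iterated along the tree of words, every branch being followed
    until its ratio drops below the threshold. *)
Lemma mu_stopseq n b A : closed A ->
  mu A = (\sum_(u <- stopseq r n b) (pw u)%:E * mu (word_map S u @^-1` A))%E.
Proof.
elim: n b A => [|n IH] b A cA /=.
  by rewrite big_seq1 word_prod_nil mul1e.
case: ifP => _; first by rewrite big_seq1 word_prod_nil mul1e.
rewrite big_allpairs_dep/= mu_self_similar_closed// big_enum/=.
apply: eq_bigr => i _.
have cSA := similarity_closed_preimage _ _ _ (r_gt0 i) (S_sim i) cA.
rewrite (IH (b / r i) _ cSA) ge0_sume_distrr; last first.
  by move=> u _; rewrite mule_ge0// lee_fin ltW.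
by apply: eq_bigr => u _; rewrite word_prod_cons EFinM muleA.
Qed.

(** A ball that is mapped into itself with room to spare has full mass: by
    self-similarity the mass outside of it is at most the mass outside a larger
    ball, and repeating this pushes the radius to infinity. *)
Lemma exists_invariant_ball : exists Q : R, [/\ 0 < Q,
  forall i, edist (S i 0) 0 + r i * Q <= Q & mu (eball 0 Q) = 1%E].
Proof.
pose a := \sum_i edist (S i 0) 0.
have a_ge i : edist (S i 0) 0 <= a.
  by rewrite /a (bigD1 i)//= lerDl sumr_ge0// => j _; exact: edist_ge0.
have k1 := rmax_lt1 r01; have k_ge := rmax_ge r01; have k0 := rmax_ge0 r01.
set k := rmax r in k1 k_ge k0.
have k_gt0 : 0 < k by apply: lt_le_trans (k_ge ord0).
(* [c] is the fixed point of [x => k * x + a]. *)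
pose c := a / (1 - k).
have aE : a = (1 - k) * c by rewrite /c mulrC divfK// gt_eqF// subr_gt0.
have a0 : 0 <= a by apply: sumr_ge0 => j _; exact: edist_ge0.
have c0 : 0 <= c by rewrite divr_ge0// subr_ge0 ltW.
have step (t : R) : 0 <= t -> (mu (eball 0 (c + t / k)) <= mu (eball 0 (c + t)))%E.
  move=> t0; rewrite [leRHS](mu_self_similar_closed _ (closed_eball _ _)).
  have -> : mu (eball 0 (c + t / k)) =
      (\sum_i (p i)%:E * mu (eball 0 (c + t / k)))%E.
    rewrite -ge0_sume_distrl; last by move=> i _; rewrite lee_fin ltW.
    by rewrite sumEFin p_sum mul1e.
  apply: lee_sum => i _; apply: lee_wpmul2l; first by rewrite lee_fin ltW.
  apply: le_measure; rewrite ?inE.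
  - exact: closed_measurable (closed_eball _ _).
  - apply: closed_measurable.
    exact: similarity_closed_preimage (r_gt0 i) (S_sim i) (closed_eball _ _).
  move=> x; rewrite /eball /= => xin.
  have := edist_triangle (S i 0) 0 (S i x); rewrite S_sim (edistC 0 (S i 0)).
  have : r i * edist 0 x <= k * (c + t / k).
    by rewrite ler_pM// ?edist_ge0 ?(ltW (r_gt0 i)).
  have -> : k * (c + t / k) = k * c + t by field; rewrite gt_eqF.
  by have := a_ge i; rewrite aE; lra.
have iter n (t : R) : 0 <= t -> (mu (eball 0 (c + t / k ^+ n)) <= mu (eball 0 (c + t)))%E.
  elim: n t => [|n IH] t t0; first by rewrite expr0 divr1.
  apply: le_trans (step t t0); rewrite exprS invfM mulrA.
  by apply: IH; rewrite divr_ge0.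
have big K : (mu (eball 0 K%:R) <= mu (eball 0 (c + 1)))%E.
  have [n nK] : exists n, k ^+ n <= K.+1%:R^-1.
    by apply: (stopseq_fuel r01); rewrite invr_gt0.
  apply: le_trans (iter n 1 ler01).
  apply: le_measure; rewrite ?inE; [exact: closed_measurable (closed_eball _ _)..|].
  move=> x; rewrite /eball /= => /le_trans; apply.
  have kn0 : 0 < k ^+ n by rewrite exprn_gt0.
  rewrite mul1r; apply: (@le_trans _ _ (k ^+ n)^-1); last by rewrite lerDr.
  apply: (@le_trans _ _ K.+1%:R); first by rewrite ler_nat.
  by rewrite -[leLHS]invrK lef_pV2 ?posrE ?invr_gt0.
exists (c + 1); split; first by lra.
  move=> i; have := a_ge i; rewrite aE.
  have : r i * (c + 1) <= k * (c + 1) by rewrite ler_wpM2r ?k_ge//; lra.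
  by move: k1; lra.
apply/eqP; rewrite eq_le; apply/andP; split.
  by apply: probability_le1; exact: closed_measurable (closed_eball _ _).
pose F K : set (borelRd R d.+1) := eball 0 K%:R.
have mF K : measurable (F K) by exact: closed_measurable (closed_eball _ _).
have UF : \bigcup_K F K = [set: borelRd R d.+1].
  apply/seteqP; split => // x _; have x0 := edist_ge0 (0 : 'rV[R]_d.+1) x.
  exists (Num.truncn (edist 0 x)).+1 => //; rewrite /F /eball /=.
  by apply/ltW; have /andP[] := truncn_itv x0.
have ndF : nondecreasing_seq F.
  move=> m n mn; apply/subsetPset => x; rewrite /F /eball /= => /le_trans; apply.
  by rewrite ler_nat.
have cv : (mu \o F) n @[n --> \oo] --> mu [set: borelRd R d.+1].
  rewrite -UF; apply: nondecreasing_cvg_mu => //.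
  by rewrite UF; exact: measurableT.
have -> : 1%E = mu [set: borelRd R d.+1] by rewrite probability_setT.
rewrite -(cvg_lim _ cv)//; apply: lime_le; first by apply/cvg_ex; eexists; exact: cv.
by apply: nearW => K; exact: big.
Qed.

Section SupportBall.
Context {Q : R} (Q_gt0 : 0 < Q) (Q_inv : forall i, edist (S i 0) 0 + r i * Q <= Q).
Context (mu_Q : mu (eball 0 Q) = 1%E).
Local Notation cyl := (cyl S r Q).

Lemma mu_disjoint0 A : closed A -> A `&` eball 0 Q = set0 -> mu A = 0%E.
Proof.
move=> cA AQ; have mA := closed_measurable _ cA.
have mQ := closed_measurable _ (closed_eball (0 : 'rV[R]_d.+1) Q).
have h : (mu A + 1 <= 1)%E.
  rewrite -{1}mu_Q -measureU//; exact: probability_le1 (measurableU _ _ mA mQ).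
apply/eqP; rewrite eq_le measure_ge0 andbT.
by rewrite -(@leeD2rE _ 1%E)// add0e.
Qed.

(** Words whose cylinder misses [A] contribute nothing, since the measure lives on
    the invariant ball; the others contribute at most their full weight. *)
Lemma mu_le_meeting n b A : closed A ->
  fine (mu A) <=
    \sum_(u <- stopseq r n b | `[< (cyl u `&` A) !=set0 >]) pw u.
Proof.
move=> cA; have mA := closed_measurable _ cA.
rewrite -lee_fin fineK ?fin_num_measure// -sumEFin (mu_stopseq n b _ cA).
rewrite [leRHS]big_mkcond/=; apply: lee_sum => u _.
have cuA := closed_word_preimage u _ cA.
case: asboolP => [_|no].
  rewrite -[leRHS]mule1; apply: lee_wpmul2l; first by rewrite lee_fin ltW.
  by apply: probability_le1; exact: closed_measurable.
rewrite mu_disjoint0 ?mule0//; apply/seteqP; split => // y [Ay Qy].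
apply: no; exists (word_map S u y); split => //.
exact: (word_map_cyl r01 S_sim).
Qed.

Lemma mu_ge_cyl u A : closed A -> cyl u `<=` A -> pw u <= fine (mu A).
Proof.
move=> cA uA; have mA := closed_measurable _ cA.
rewrite -lee_fin fineK ?fin_num_measure//.
apply: le_trans (mu_word_preimage_le u _ cA).
rewrite -[leLHS]mule1; apply: lee_wpmul2l; first by rewrite lee_fin ltW.
rewrite -mu_Q; apply: le_measure; rewrite ?inE.
- exact: closed_measurable (closed_eball _ _).
- exact: closed_measurable (closed_word_preimage u _ cA).
by move=> y Qy; apply: uA; exact: (word_map_cyl r01 S_sim).
Qed.

Lemma mu_eball_gt0 x e : measure_support mu x -> 0 < e -> 0 < fine (mu (eball x e)).
Proof.
move=> sx e0; have [V [oV Vx Ve]] := open_sub_eball x _ e0.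
have mB := closed_measurable _ (closed_eball x e).
have mV : measurable (V : set (borelRd R d.+1)) by exact: sub_sigma_algebra.
rewrite -lte_fin fineK ?fin_num_measure//.
by apply: lt_le_trans (sx _ oV Vx) _; apply: le_measure; rewrite ?inE.
Qed.

Lemma support_of_cyl x : (forall e, 0 < e -> exists u, cyl u `<=` eball x e) ->
  measure_support mu x.
Proof.
move=> H V oV Vx; have [e e0 eV] := eball_sub_open _ _ oV Vx.
have [u ue] := H e e0.
have mB := closed_measurable _ (closed_eball x e).
have mV : measurable (V : set (borelRd R d.+1)) by exact: sub_sigma_algebra.
apply: (@lt_le_trans _ _ (mu (eball x e))); last by apply: le_measure; rewrite ?inE.
rewrite -(fineK (fin_num_measure mu _ mB)) lte_fin.
by apply: lt_le_trans (mu_ge_cyl u _ (closed_eball x e) ue).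
Qed.

(** The half ball around a point of the support has positive mass, hence meets a
    cylinder, whose diameter is at most the other half of the radius. *)
Lemma exists_cyl_in_ball n b x e : measure_support mu x -> 0 < b ->
  rmax r ^+ n <= b -> 4 * Q * b <= e ->
  exists2 u, u \in stopseq r n b & cyl u `<=` eball x e.
Proof.
move=> sx b0 nb Qb; have e0 : 0 < e.
  by apply: lt_le_trans Qb; rewrite !mulr_gt0.
have e2 : 0 < e / 2 by lra.
have mpos := mu_eball_gt0 _ _ sx e2.
have : exists2 u, u \in stopseq r n b & (cyl u `&` eball x (e / 2)) !=set0.
  apply: contrapT => no; move: mpos; apply/negP; rewrite -leNgt.
  apply: le_trans (mu_le_meeting n b _ (closed_eball _ _)) _.
  rewrite big_seq_cond big1// => u /andP[uin /asboolP um].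
  by exfalso; apply: no; exists u.
move=> [u uin [y [uy xy]]]; exists u => // z uz.
have [ub _] := stopseq_stops r01 _ _ _ b0 nb uin.
have := cyl_diam _ _ _ uy uz; have := edist_triangle y x z.
move: xy; rewrite /eball /=.
have : 2 * Q * rw u <= 2 * Q * b by rewrite ler_pM2l// mulr_gt0.
by move: Qb; lra.
Qed.

(** Balls around points of [cyl (w ++ v)] may meet cylinders of other branches, whose
    mass could be much larger than that of [w].  For the word [v] of Schief's
    argument this does not happen: all cylinders of comparable size that meet such
    a ball lie below [w], and their number is bounded. *)
Lemma exists_separating_word : open_set_condition S ->
  exists (v : seq 'I_N.+1) (M : nat), forall w x (e : R), cyl (w ++ v) x ->
    0 < e <= rw (w ++ v) -> fine (mu (eball x e)) <= M%:R * pw w.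
Proof.
move=> osc; have C0 : 0 <= 2 * Q + 1 by have := Q_gt0; lra.
have [v [M HM]] := exists_maximal_neighbourhood r01 S_sim _ osc C0.
exists v, M => w x e wvx /andP[e0 ew].
set b := rw (w ++ v) in ew *.
have b0 : 0 < b by exact: rw_gt0.
have [n nb] := stopseq_fuel r01 _ b0.
apply: le_trans (mu_le_meeting n b _ (closed_eball x e)) _.
rewrite -big_filter; set L := [seq u <- _ | _].
have uL : uniq L by rewrite filter_uniq// stopseq_uniq.
have nL : {in L, forall u, neighbour S r (2 * Q + 1) (w ++ v) u}.
  move=> u; rewrite mem_filter => /andP[/asboolP[y [uy xy]] uin].
  have su := stopseq_stops r01 _ _ _ b0 nb uin.
  split; first exact: su.
  case: su => ub _; move: uy xy wvx; rewrite /cyl /eball /= -/b.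
  have := edist_triangle y (word_map S u 0) (word_map S (w ++ v) 0).
  have := edist_triangle x y (word_map S (w ++ v) 0).
  rewrite (edistC y x) (edistC x (word_map S (w ++ v) 0)).
  have : rw u * Q <= b * Q by rewrite ler_pM2r.
  by rewrite mulrDl mul1r -mulrA (mulrC Q b); lra.
have [sL pL] := HM w L uL nL.
apply: (@le_trans _ _ (\sum_(u <- L) pw w)).
  rewrite big_seq [leRHS]big_seq; apply: ler_sum => u uin.
  have /prefixP[s ->] := pL u uin.
  rewrite word_prod_cat ger_pMr// prodr_ile1// => i _.
  by rewrite (ltW (p_gt0 i)) prob_le1.
by rewrite big_const_seq count_predT iter_addr addr0 -[leLHS]mulr_natl ler_pM2r// ler_nat.
Qed.

End SupportBall.
End SelfSimilarMeasure.

(** * Digit sequences avoiding cylinders of small total mass *)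

Section AllLists.
Context {T : eqType}.
Implicit Types (s c : seq T) (m : nat).

Fixpoint all_lists s m : seq (seq T) :=
  if m is m'.+1 then [seq x :: c | x <- s, c <- all_lists s m'] else [:: [::]].

Lemma all_lists_uniq s m : uniq s -> uniq (all_lists s m).
Proof.
move=> us; elim: m => //= m IH; apply: allpairs_uniq_dep => //.
by move=> [i u] [j v] _ _ /= [-> ->].
Qed.

Lemma mem_all_lists s m c : c \in all_lists s m -> size c = m /\ {subset c <= s}.
Proof.
elim: m c => [|m IH] c /=; first by rewrite inE => /eqP->.
move=> /allpairsPdep[x [c' [xs /IH[<- sub] ->]]]; split => // y.
by rewrite inE => /predU1P[->//|/sub].
Qed.

Lemma size_all_lists s m : size (all_lists s m) = (size s ^ m)%N.
Proof. by elim: m => //= m IH; rewrite size_allpairs IH expnS. Qed.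

End AllLists.

Section AvoidingDigits.
Context {R : realType} {k : nat}.
Local Notation digits := (seq 'I_k.+1).
Implicit Types (c : digits) (f : digits -> R) (m n : nat).

Definition all_digits m : seq digits := all_lists (enum 'I_k.+1) m.

Lemma all_digits_uniq m : uniq (all_digits m).
Proof. exact: all_lists_uniq (enum_uniq _). Qed.

Lemma size_all_digits m c : c \in all_digits m -> size c = m.
Proof. by move=> /mem_all_lists[]. Qed.

(** Conditional expectation of [f], given that the digits start with [c], when
    [m] further digits are drawn uniformly. *)
Fixpoint mean m f c : R :=
  if m is m'.+1 then (\sum_j mean m' f (rcons c j)) / k.+1%:R else f c.

Lemma mean_ge0 m f c : (forall c, 0 <= f c) -> 0 <= mean m f c.
Proof.
move=> f0; elim: m c => //= m IH c.
by rewrite divr_ge0// sumr_ge0.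
Qed.

Lemma mean_all_digits m f c :
  mean m f c = (\sum_(u <- all_digits m) f (c ++ u)) / k.+1%:R ^+ m.
Proof.
elim: m c => [|m IH] c.
  by rewrite big_seq1 cats0 expr0 divr1.
rewrite [mean _ _ _]/=.
rewrite /all_digits /= big_allpairs_dep/= big_enum/= exprSr invfM mulrA; congr (_ / _).
rewrite mulr_suml; apply: eq_bigr => j _; rewrite IH; congr (_ / _).
by apply: eq_bigr => u _; rewrite cat_rcons.
Qed.

(** Greedy form of the union bound for the uniform measure on infinite digit
    sequences: the conditional probabilities of the bad events sum to less than
    one at the root, and some child of every node does not increase the sum. *)
Lemma exists_avoiding_digits (n : nat -> nat) (P : nat -> digits -> bool) :
  (\sum_(0 <= i <oo) ((size [seq c <- all_digits (n i) | P i c])%:R /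
     k.+1%:R ^+ n i : R)%:E < 1)%E ->
  exists w : nat -> 'I_k.+1, forall i, ~~ P i (mkseq w (n i)).
Proof.
(* [g i c] is the conditional probability of the event [P i] given [c]. *)
pose f i c : R := (P i (take (n i) c))%:R.
pose g i c := mean (n i - size c) (f i) c.
have f0 i c : 0 <= f i c by rewrite ler0n.
have g0 i c : (0 <= (g i c)%:E)%E by rewrite lee_fin mean_ge0.
have gchild i c : \sum_j g i (rcons c j) = k.+1%:R * g i c.
  rewrite /g; under eq_bigr do rewrite size_rcons.
  case: (ltnP (size c) (n i)) => h.
    by rewrite -[in RHS](@prednK (n i - size c)) ?subn_gt0// -subnS/= mulrCA divff// mulr1.
  have -> : (n i - (size c).+1 = 0)%N by lia.
  have -> : (n i - size c = 0)%N by lia.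
  rewrite /= /f (eq_bigr (fun=> (P i (take (n i) c))%:R)).
    by rewrite sumr_const card_ord -[LHS]mulr_natl.
  by move=> j _; rewrite -cats1 takel_cat.
pose M c := (\sum_(0 <= i <oo) (g i c)%:E)%E.
have Mchild c : (M c < 1)%E -> exists j, (M (rcons c j) < 1)%E.
  move=> Mc; apply: contrapT => no.
  have ge1 j : (1 <= M (rcons c j))%E.
    by rewrite leNgt; apply/negP => h; apply: no; exists j.
  have : (\sum_(j : 'I_k.+1) M (rcons c j) = k.+1%:R%:E * M c)%E.
    rewrite /M -nneseries_sum// -nneseriesZl//; apply: eq_eseriesr => i _.
    by rewrite sumEFin gchild EFinM.
  apply/eqP; rewrite gt_eqF//.
  apply: (@lt_le_trans _ _ (\sum_(j : 'I_k.+1) 1)%E); last exact: lee_sum.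
  rewrite sumEFin sumr_const card_ord -[ltRHS]mule1.
  by rewrite lte_pmul2l.
move=> H.
have M0 : (M [::] < 1)%E.
  rewrite /M (eq_eseriesr (g := fun i => ((size [seq c <- all_digits (n i) | P i c])%:R /
     k.+1%:R ^+ n i : R)%:E)) // => i _.
  rewrite /g /= subn0 mean_all_digits; congr (_ / _)%:E.
  rewrite size_filter -sum1_count natr_sum [RHS]big_mkcond/= [LHS]big_seq [RHS]big_seq.
  apply: eq_bigr => c /size_all_digits sc; rewrite /f -sc take_size.
  by case: (P i c).
pose next c := if pselect (exists j, (M (rcons c j) < 1)%E) is left h
  then projT1 (cid h) else ord0.
have nextP c : (M c < 1)%E -> (M (rcons c (next c)) < 1)%E.
  by move=> /Mchild h; rewrite /next; case: pselect => // h'; case: cid.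
pose pre := fix F m := if m is m'.+1 then rcons (F m') (next (F m')) else [::].
have preP m : (M (pre m) < 1)%E by elim: m => //= m; exact: nextP.
exists (fun m => next (pre m)) => i.
have preE m : mkseq (fun m => next (pre m)) m = pre m.
  by elim: m => //= m IH; rewrite mkseqS IH.
rewrite preE; apply/negP => Pi; have := preP (n i); apply/negP; rewrite -leNgt.
apply: (@le_trans _ _ (\sum_(0 <= j < i.+1) (g j (pre (n i)))%:E)%E); last first.
  exact: nneseries_lim_ge.
rewrite big_nat_recr//= -[leLHS]add0e leeD//; first by apply: sume_ge0 => j _.
have sp : size (pre (n i)) = n i by rewrite -preE size_mkseq.
by rewrite /g sp subnn /= /f take_oversize ?sp// Pi.
Qed.

End AvoidingDigits.
Arguments all_digits : clear implicits.

(** * Powers and logarithms near zero *)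

Section RealPowers.
Context {R : realType}.
Implicit Types a x y : R.

Lemma powR_expR a x : 0 < a -> a `^ x = expR (x * ln a).
Proof. by move=> a0; rewrite /powR gt_eqF. Qed.

Lemma powR_base_lt1 a x y : 0 < a -> a <= 1 -> x <= y -> a `^ y <= a `^ x.
Proof.
move=> a0 a1 xy; rewrite !powR_expR// ler_expR ler_wnM2r//.
exact: ln_le0.
Qed.

Lemma powR_lt1 a x : 0 < a < 1 -> 0 < x -> a `^ x < 1.
Proof.
move=> /andP[a0 a1] x0; rewrite powR_expR// expR_lt1 pmulr_rlt0//.
by rewrite ln_lt0// a0.
Qed.

End RealPowers.

Section LogNearZero.
Context {R : realType}.

Lemma near0_lt_neg_ln (K : R) : \forall e \near (0 : R)^'+, 0 < e /\ K < - ln e.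
Proof.
have h : 0 < expR (- K) by exact: expR_gt0.
near=> e.
have e0 : 0 < e by [].
have eK : e < expR (- K) by near: e; exact: nbhs_right_lt.
by split => //; rewrite ltrNr -(expRK (- K)) ltr_ln ?posrE.
Unshelve. all: by end_near.
Qed.

(** A quotient with numerator within a bounded distance of [a] times the
    denominator [- ln e] tends to [a]. *)
Lemma cvg_ratio_neg_ln (f : R -> R) (a K : R) :
  (\forall e \near (0 : R)^'+, `|- f e - a * - ln e| <= K) ->
  f e / ln e @[e --> (0 : R)^'+] --> a.
Proof.
move=> H; apply/cvgrPdist_le => eta eta0.
near=> e.
have [e0 /ltW D1] : 0 < e /\ `|K| / eta + 1 < - ln e.
  by near: e; exact: near0_lt_neg_ln.
have HK : `|- f e - a * - ln e| <= K by near: e.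
have K0 : 0 <= `|K| / eta by rewrite divr_ge0// ltW.
have D0 : 0 < - ln e by lra.
have lne0 : ln e != 0 by rewrite lt_eqF// -oppr_gt0.
have -> : a - f e / ln e = - ((- f e - a * - ln e) / - ln e) by field.
rewrite normrN normrM normfV (gtr0_norm D0) ler_pdivrMr//.
apply: le_trans HK _; apply: le_trans (ler_norm K) _.
by rewrite mulrC -ler_pdivrMr//; lra.
Unshelve. all: by end_near.
Qed.

End LogNearZero.

(** * Level sets carried by homogeneous subsystems *)

Section HomogeneousSubsystem.
Context {R : realType} {d N : nat}.
Context {S : 'I_N.+1 -> 'rV[R]_d.+1 -> 'rV[R]_d.+1} {r p : 'I_N.+1 -> R}.
Context (r01 : forall i, 0 < r i < 1).
Context (S_sim : forall i, similarity (r i) (S i)).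
Context (p_gt0 : forall i, 0 < p i) (p_sum : \sum_i p i = 1).
Context {mu : probability (borelRd R d.+1) R}.
Context (mu_ss : self_similar_measure mu p S) (S_osc : open_set_condition S).
Context {Q : R} (Q_gt0 : 0 < Q) (Q_inv : forall i, edist (S i 0) 0 + r i * Q <= Q).
Context (mu_Q : mu (eball 0 Q) = 1%E).
Implicit Types (u w : seq 'I_N.+1) (x y z : 'rV[R]_d.+1) (A : set 'rV[R]_d.+1).
Local Notation rw := (word_prod r).
Local Notation pw := (word_prod p).
Local Notation cyl := (cyl S r Q).

Let r_gt0 i : 0 < r i. Proof. by have /andP[] := r01 i. Qed.
Let rw_gt0 w : 0 < rw w. Proof. exact: word_prod_gt0. Qed.
Let pw_gt0 w : 0 < pw w. Proof. exact: word_prod_gt0. Qed.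

Context {v : seq 'I_N.+1} {M : nat}.
Context (v_sep : forall w x (e : R), cyl (w ++ v) x ->
  0 < e <= rw (w ++ v) -> fine (mu (eball x e)) <= M%:R * pw w).
Context {k l : nat} {W : 'I_k.+1 -> seq 'I_N.+1} {rho q : R}.
Context (W_inj : injective W) (W_size : forall j, size (W j) = l).
Context (W_r : forall j, rw (W j) = rho) (W_p : forall j, pw (W j) = q).
Context (W_v : forall j, exists w, W j = w ++ v) (rho_lt1 : rho < 1).
Implicit Types c : seq 'I_k.+1.

Definition code c : seq 'I_N.+1 := flatten [seq W j | j <- c].

Lemma code_cat c c' : code (c ++ c') = code c ++ code c'.
Proof. by rewrite /code map_cat flatten_cat. Qed.

Lemma code_rcons c j : code (rcons c j) = code c ++ W j.
Proof. by rewrite -cats1 code_cat /code /= cats0. Qed.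

Lemma rw_code c : rw (code c) = rho ^+ size c.
Proof.
elim: c => [|j c IH]; first by rewrite word_prod_nil.
by rewrite /code /= word_prod_cat -/(code c) IH W_r exprS.
Qed.

Lemma pw_code c : pw (code c) = q ^+ size c.
Proof.
elim: c => [|j c IH]; first by rewrite word_prod_nil.
by rewrite /code /= word_prod_cat -/(code c) IH W_p exprS.
Qed.

Lemma size_code c : size (code c) = (l * size c)%N.
Proof.
elim: c => [|j c IH]; first by rewrite muln0.
by rewrite /code /= size_cat -/(code c) IH W_size mulnS.
Qed.

Lemma code_inj c c' : size c = size c' -> code c = code c' -> c = c'.
Proof.
elim: c c' => [|j c IH] [|j' c']//= [sc].
move/eqP; rewrite /code /= eqseq_cat ?W_size// => /andP[/eqP/W_inj-> /eqP h].
by rewrite (IH c').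
Qed.

Lemma code_prefix c c' : size c = size c' -> prefix (code c) (code c') -> c = c'.
Proof.
move=> sc /prefixP[s E]; apply: code_inj => //.
have : size s = 0%N by have := congr1 size E; rewrite size_cat !size_code sc; lia.
by move/size0nil => s0; rewrite E s0 cats0.
Qed.

Let rho_gt0 : 0 < rho. Proof. by rewrite -(W_r ord0). Qed.
Let q_gt0 : 0 < q. Proof. by rewrite -(W_p ord0). Qed.
Let q_le1 : q <= 1.
Proof.
by rewrite -(W_p ord0); apply: prodr_ile1 => i _; rewrite (ltW (p_gt0 i)) (prob_le1 p_gt0 p_sum).
Qed.

Lemma exists_coded_point (w : nat -> 'I_k.+1) :
  exists x, forall n, cyl (code (mkseq w n)) x.
Proof.
apply: (eball_nested (fun n => word_map S (code (mkseq w n)) 0)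
  (fun n => rw (code (mkseq w n)) * Q)).
- by move=> n; rewrite mkseqS code_rcons; exact: cyl_cat.
- by move=> n; rewrite mulr_ge0// ltW.
- under eq_cvg do rewrite rw_code size_mkseq mulrC.
  by apply: cvg_geometric; rewrite gtr0_norm.
Qed.

Lemma exists_pow_le (e : R) : 0 < e -> exists n, rho ^+ n <= e.
Proof.
move=> e0; have h := @cvg_geometric _ 1 rho; rewrite gtr0_norm// in h.
have [n _ H] := cvgr_le _ (h rho_lt1) _ e0.
by exists n; have := H n (leqnn n); rewrite /= mul1r.
Qed.

Lemma exists_pow_between (e : R) : 0 < e <= 1 ->
  exists n, rho ^+ n.+1 < e <= rho ^+ n.
Proof.
move=> /andP[e0 e1].
have ex : exists n, rho ^+ n.+1 < e.
  have [n nb] := exists_pow_le _ e0; exists n.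
  by apply: lt_le_trans nb; rewrite exprS gtr_pMl// exprn_gt0.
case: (ex_minnP ex) => n nb nmin; exists n; rewrite nb /= leNgt.
apply/negP; case: n nb nmin => [|n] nb nmin; first by rewrite expr0 ltNge e1.
by move=> /nmin; rewrite ltnn.
Qed.

Section CodedPoint.
Context {w : nat -> 'I_k.+1} {x : 'rV[R]_d.+1}.
Context (x_cyl : forall n, cyl (code (mkseq w n)) x).

Lemma coded_point_support : measure_support mu x.
Proof.
apply: (support_of_cyl r01 S_sim p_gt0 mu_ss mu_Q) => e e0.
have Q2 : 0 < 2 * Q by rewrite mulr_gt0.
have [n nb] := exists_pow_le (e / (2 * Q)) (divr_gt0 e0 Q2).
exists (code (mkseq w n)) => y cy; apply: le_trans (cyl_diam _ _ _ (x_cyl n) cy) _.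
by rewrite rw_code size_mkseq mulrC -ler_pdivlMr.
Qed.

Lemma coded_point_mu_le n e : 0 < e <= rho ^+ n.+1 ->
  fine (mu (eball x e)) <= M%:R * (q ^+ n.+1 / pw v).
Proof.
have [u uE] := W_v (w n).
have cE : code (mkseq w n.+1) = (code (mkseq w n) ++ u) ++ v.
  by rewrite mkseqS code_rcons uE catA.
move=> en; have -> : q ^+ n.+1 / pw v = pw (code (mkseq w n) ++ u).
  apply: (canLR (mulfK _)); first by rewrite gt_eqF.
  by rewrite -word_prod_cat -cE pw_code size_mkseq.
by apply: v_sep; rewrite -cE ?rw_code ?size_mkseq.
Qed.

Lemma coded_point_mu_ge n e : 2 * Q * rho ^+ n <= e -> q ^+ n <= fine (mu (eball x e)).
Proof.
move=> ne; have <- : pw (code (mkseq w n)) = q ^+ n by rewrite pw_code size_mkseq.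
apply: (mu_ge_cyl r01 S_sim p_gt0 mu_ss mu_Q) => [|y cy]; first exact: closed_eball.
apply: le_trans (cyl_diam _ _ _ (x_cyl n) cy) _.
by rewrite rw_code size_mkseq.
Qed.

(** Every block of the code ends in the separating word, so at each level both the
    upper and the lower bound for the mass of balls of radius about [rho ^+ n] are
    constant multiples of [q ^+ n]. *)
Lemma coded_point_log_ratio :
  log_ratio mu x e @[e --> (0 : R)^'+] --> ln q / ln rho.
Proof.
have L0 : 0 < - ln rho by rewrite oppr_gt0 ln_lt0// rho_gt0.
have P0 : 0 <= - ln q by rewrite oppr_ge0 ln_le0.
have Q2 : 0 < 2 * Q by rewrite mulr_gt0.
(* [n0] more levels absorb the factor [2 * Q] in the diameters of cylinders. *)
have [n0 n0P] := exists_pow_le _ (divr_gt0 ltr01 Q2).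
set L := - ln rho in L0; set P := - ln q in P0.
pose c1 := ln (M%:R / pw v).
have -> : ln q / ln rho = P / L by rewrite /P /L invrN mulrNN.
apply: (cvg_ratio_neg_ln _ _ (`|c1| + P * n0.+2%:R)).
near=> e.
have [e0 /ltW D1] : 0 < e /\ `|L| < - ln e by near: e; exact: near0_lt_neg_ln.
rewrite gtr0_norm// in D1; set D := - ln e in D1 *.
have e_le1 : e <= 1.
  by rewrite -ler_ln ?posrE// ln1 -oppr_ge0; apply: le_trans D1; exact: ltW.
have [n /andP[n1 n2]] := exists_pow_between e (introT andP (conj e0 e_le1)).
have lnrho m : ln (rho ^+ m) = - (m%:R * L).
  by rewrite lnXn// -[LHS]mulr_natl /L mulrN opprK.
have lnq m : ln (q ^+ m) = - (m%:R * P).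
  by rewrite lnXn// -[LHS]mulr_natl /P mulrN opprK.
have hn1 : D < n.+1%:R * L.
  by rewrite /D ltrNl -lnrho ltr_ln ?posrE// exprn_gt0.
have hn2 : n%:R * L <= D.
  by rewrite /D lerNr -lnrho ler_ln ?posrE// exprn_gt0.
have n_gt0 : (0 < n)%N.
  case: (n) hn1 => // h; move: D1; rewrite leNgt; move: h; rewrite mul1r => ->//.
set a := P / L.
have aD1 : n%:R * P <= a * D.
  have -> : n%:R * P = a * (n%:R * L) by rewrite /a; field; rewrite gt_eqF.
  by rewrite ler_wpM2l// divr_ge0// ltW.
have aD2 : a * D <= n.+1%:R * P.
  have -> : n.+1%:R * P = a * (n.+1%:R * L) by rewrite /a; field; rewrite gt_eqF.
  by rewrite ler_wpM2l ?divr_ge0// ltW.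
have mpos := mu_eball_gt0 _ _ coded_point_support e0.
have up : n%:R * P - c1 <= - ln (fine (mu (eball x e))).
  case: (n) n_gt0 n2 => // m _ n2.
  have := coded_point_mu_le m e (introT andP (conj e0 n2)).
  rewrite mulrCA => h.
  have M0 : 0 < M%:R / pw v.
    by have := lt_le_trans mpos h; rewrite pmulr_rgt0// exprn_gt0.
  have qm0 : 0 < q ^+ m.+1 by rewrite exprn_gt0.
  have : ln (fine (mu (eball x e))) <= ln (q ^+ m.+1) + c1.
    rewrite -lnM// ler_ln// posrE; exact: mulr_gt0 qm0 M0.
  rewrite lnq; lra.
have low : - ln (fine (mu (eball x e))) <= (n.+1 + n0)%:R * P.
  have h : 2 * Q * rho ^+ (n.+1 + n0) <= e.
    apply: le_trans (ltW n1); rewrite exprD mulrCA ger_pMr ?exprn_gt0//.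
    by rewrite mulrC -ler_pdivlMr.
  have := coded_point_mu_ge _ _ h.
  by rewrite -ler_ln ?posrE ?exprn_gt0// lnq lerNl.
rewrite ler_norml; have := ler_norm c1; have := ler_norm (- c1); rewrite normrN.
have : 0 <= n0%:R * P by rewrite mulr_ge0.
move: up low aD1 aD2 P0; rewrite natrD -!natr1 -/P.
set y := ln _; rewrite !(mulrDl, mulrDr, mul1r, mulr1) (mulrC P).
by move=> *; apply/andP; lra.
Unshelve. all: by end_near.
Qed.

End CodedPoint.
(** Cylinders of the same level are incomparable and of equal size, so few of them
    meet a set whose diameter is at most that size. *)
Lemma count_meeting : exists M1 : nat, forall n (U : set 'rV[R]_d.+1),
  (forall x y, U x -> U y -> edist x y <= rho ^+ n) ->
  (size [seq c <- all_digits k n | `[< (cyl (code c) `&` U) !=set0 >]] <= M1)%N.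
Proof.
have [M1 HM1] := osc_bounded_overlap r01 S_sim 1 (Q + 1) S_osc ltr01
  (addr_ge0 (ltW Q_gt0) ler01).
exists M1 => n U Un; set L := [seq c <- _ | _].
have [->//|] := eqVneq L [::].
case E : L => [//|c0 L'] _; rewrite -E.
have LP c : c \in L -> size c = n /\ (cyl (code c) `&` U) !=set0.
  by rewrite mem_filter => /andP[/asboolP h /size_all_digits].
have [_ [x0 [_ Ux0]]] : size c0 = n /\ (cyl (code c0) `&` U) !=set0.
  by apply: LP; rewrite E mem_head.
have rn0 : 0 < rho ^+ n by rewrite exprn_gt0.
rewrite -(size_map code); apply: (HM1 (rho ^+ n) x0) => //.
- rewrite map_inj_in_uniq ?filter_uniq ?all_digits_uniq// => c c' /LP[sc _] /LP[sc' _].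
  by apply: code_inj; rewrite sc sc'.
- move=> _ _ /mapP[c /LP[sc _] ->] /mapP[c' /LP[sc' _] ->] h.
  by rewrite (code_prefix c c')// sc sc'.
- by move=> _ /mapP[c /LP[sc _] ->]; rewrite rw_code sc mul1r lexx.
- move=> _ /mapP[c /LP[sc [y [cy Uy]]] ->].
  have := Un _ _ Uy Ux0; move: cy; rewrite /cyl /eball /= rw_code sc => cy yx.
  have := edist_triangle y (word_map S (code c) 0) x0.
  by rewrite mulrDl mul1r (mulrC Q); lra.
Qed.

(** Mass distribution: the uniform measure on codes gives a cylinder of level [n]
    the mass [k.+1 ^- n <= rho `^ t ^+ n], comparable to the [t]-th power of its
    diameter.  A cover of small [s]-dimensional size, [s < t], therefore misses
    some code. *)
Lemma homogeneous_spectrum_ge (t : R) : 1 <= k.+1%:R * rho `^ t ->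
  (t%:E <= multifractal_spectrum mu (ln q / ln rho))%E.
Proof.
move=> kt; rewrite /multifractal_spectrum; set X := [set x | _].
have coded_X (w : nat -> 'I_k.+1) x : (forall n, cyl (code (mkseq w n)) x) -> X x.
  by move=> xw; split; [exact: coded_point_support xw|exact: coded_point_log_ratio xw].
have X0 : X !=set0.
  have [x xw] := exists_coded_point (fun=> ord0).
  by exists x; exact: coded_X xw.
rewrite /hausdorff_dim ifF; last by apply/negbTE/set0P.
apply: le_ereal_inf_tmp => _ [s [s0 Hs] <-]; rewrite lee_fin leNgt.
apply/negP => st.
have t0 : 0 < t by exact: le_lt_trans st.
have rt0 : 0 < rho `^ t by exact: powR_gt0.
have kinv : k.+1%:R^-1 <= rho `^ t.
  by rewrite -[leLHS]mul1r ler_pdivrMr// mulrC.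
have kn n : (k.+1%:R ^+ n)^-1 <= (rho `^ t) ^+ n.
  by rewrite -exprVn lerXn2r// nnegrE ?invr_ge0// ltW.
have rt1 : rho `^ t < 1 by apply: powR_lt1; rewrite ?rho_gt0.
have [M1 HM1] := count_meeting.
pose C := M1%:R * (rho `^ s)^-1.
have rs0 : 0 < rho `^ s by exact: powR_gt0.
have C0 : 0 <= C by rewrite mulr_ge0// invr_ge0 ltW.
pose eta := (4 * (C + 1))^-1.
have eta0 : 0 < eta by rewrite invr_gt0 mulr_gt0// ltr_wpDl.
have prem : (hausdorff_premeasure s 1 X < eta%:E)%E.
  apply: (@le_lt_trans _ _ 0%E); last by rewrite lte_fin.
  rewrite -Hs; apply: ereal_sup_ubound; exists 1 => //=.
have [_ [U [XU dU] <-] HU] := ereal_inf_lt prem.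
pose P i c := `[< (cyl (code c) `&` U i) !=set0 >].
(* The level [n] at which the cylinders have about the diameter of [U i]; for a
   set of diameter zero any level at which the mass is below the summable
   error term does. *)
have choose_n i : exists n : nat,
   (((size [seq c <- all_digits k n | P i c])%:R / k.+1%:R ^+ n : R)%:E
     <= C%:E * diam_pow s (U i) + (4^-1 / (2 ^ i.+1)%:R)%:E)%E.
  have small0 : 0 < 4^-1 / (2 ^ i.+1)%:R :> R by rewrite divr_gt0// ltr0n expn_gt0.
  have cntle n : (forall x y, U i x -> U i y -> edist x y <= rho ^+ n) ->
    (size [seq c <- all_digits k n | P i c])%:R / k.+1%:R ^+ n <= M1%:R * (rho `^ t) ^+ n.
    by move=> h; rewrite ler_pM ?invr_ge0 ?exprn_ge0 ?ler_nat//; exact: HM1.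
  have diam_ub x y : U i x -> U i y -> ((edist x y)%:E <= ediam (U i))%E.
    by move=> Ux Uy; apply: ereal_sup_ubound; exists (x, y).
  rewrite /diam_pow; case: eqP => [U0|/eqP/set0P[x Ux]].
    exists 0%N; rewrite mule0 add0e lee_fin.
    rewrite /= expr0 divr1 /P; case: asboolP => [[y]|_]; last exact: ltW.
    by rewrite U0 => -[].
  have := dU i; have := diam_ub x x Ux Ux; rewrite edistxx.
  case Ed : (ediam (U i)) => [D| |] //=; rewrite !lee_fin => D0 D1.
  have diamD y z : U i y -> U i z -> edist y z <= D.
    by move=> Uy Uz; rewrite -lee_fin -Ed; exact: diam_ub.
  move: D0; rewrite le_eqVlt => /predU1P[D0|D0].
    have h : 0 < (4^-1 / (2 ^ i.+1)%:R) / M1.+1%:R :> R by rewrite divr_gt0.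
    have [n _ Hn] : \forall n \near \oo,
      geometric 1 (rho `^ t) n <= (4^-1 / (2 ^ i.+1)%:R) / M1.+1%:R :> R.
      by apply: cvgr_le h; apply: cvg_geometric; rewrite gtr0_norm.
    exists n; rewrite -EFinD lee_fin.
    apply: le_trans (cntle n _) _ => [y z Uy Uz|].
      by apply: le_trans (diamD _ _ Uy Uz) _; rewrite -D0 exprn_ge0// ltW.
    apply: (@le_trans _ _ (4^-1 / (2 ^ i.+1)%:R)); last first.
      by rewrite lerDr mulr_ge0// powR_ge0.
    have := Hn n (leqnn n); rewrite /= mul1r ler_pdivlMr// mulrC.
    by apply: le_trans; rewrite ler_wpM2r ?ler_nat// exprn_ge0// ltW.
  have [n /andP[n1 n2]] := exists_pow_between D (introT andP (conj D0 D1)).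
  exists n; rewrite -EFinM -EFinD lee_fin.
  apply: le_trans (cntle n _) _ => [y z Uy Uz|].
    exact: le_trans (diamD _ _ Uy Uz) n2.
  apply: ler_wpDr; first exact: ltW.
  rewrite /C -mulrA ler_wpM2l//.
  rewrite -[leRHS]mulrC ler_pdivlMr//.
  apply: (@le_trans _ _ ((rho `^ s) ^+ n * rho `^ s)).
    rewrite ler_pM2r// lerXn2r// ?nnegrE ?powR_ge0//.
    by apply: powR_base_lt1 => //; exact: ltW.
  rewrite -exprSr -powR_mulrn ?powR_ge0// -powRrM mulrC powRrM powR_mulrn ?(ltW rho_gt0)//.
  by apply: ge0_ler_powR; rewrite ?nnegrE ?exprn_ge0 ?(ltW rho_gt0) ?(ltW D0) ?(ltW n1).
have [n nP] := choice choose_n.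
have total : (\sum_(0 <= i <oo) ((size [seq c <- all_digits k (n i) | P i c])%:R /
     k.+1%:R ^+ n i : R)%:E < 1)%E.
  have dp0 i : (0 <= diam_pow s (U i))%E.
    by rewrite /diam_pow; case: ifP => // _; exact: poweR_ge0.
  have Cdp0 i : (0 <= C%:E * diam_pow s (U i))%E by rewrite mule_ge0.
  apply: (@le_lt_trans _ _ (\sum_(0 <= i <oo)
      (C%:E * diam_pow s (U i) + (4^-1 / (2 ^ i.+1)%:R)%:E))%E).
    by apply: lee_nneseries => // i _ _; rewrite lee_fin divr_ge0// exprn_ge0.
  apply: le_lt_trans (epsilon_trick _ _ _) _ => //.
  rewrite nneseriesZl//.
  apply: (@le_lt_trans _ _ (C%:E * eta%:E + 4^-1%:E)%E).
    by rewrite leeD2r// lee_wpmul2l ?lee_fin// ltW.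
  rewrite -EFinM -EFinD lte_fin /eta.
  have : C * (4 * (C + 1))^-1 <= 4^-1.
    rewrite invfM mulrCA ger_pMr// ler_pdivrMr ?mul1r ?lerDl//.
    exact: ltr_wpDl.
  by lra.
have [w Hw] := exists_avoiding_digits n P total.
have [x xw] := exists_coded_point w.
have [i _ Ux] := XU x (coded_X _ _ xw).
by have := Hw i; rewrite /P; case: asboolP => // h _; apply: h; exists x; split.
Qed.

End HomogeneousSubsystem.

(** * Lower limits and Hausdorff null sets *)

Section ExtendedReals.
Context {R : realType}.
Implicit Types x y : \bar R.

Lemma exists_real_between x y : (x < y)%E -> exists t : R, (x < t%:E < y)%E.
Proof.
case: x y => [x| |] [y| |] //=.
- rewrite lte_fin => xy; exists ((x + y) / 2); rewrite !lte_fin.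
  by apply/andP; lra.
- by move=> _; exists (x + 1); rewrite ltry lte_fin andbT; lra.
- by move=> _; exists (y - 1); rewrite ltNyr lte_fin; lra.
- by move=> _; exists 0; rewrite ltNyr ltry.
Qed.

Lemma le_of_lt_real x y : (forall t : R, (y < t%:E)%E -> (x <= t%:E)%E) -> (x <= y)%E.
Proof.
move=> H; rewrite leNgt; apply/negP => /exists_real_between[t /andP[yt tx]].
by have := H t yt; rewrite leNgt tx.
Qed.

Context {T : choiceType} {X : filteredType T}.
Implicit Types (f g : X -> \bar R) (F : set_system X).

Lemma limf_einf_lt f F y V : (limf_einf f F < y)%E -> F V -> exists2 t, V t & (f t < y)%E.
Proof.
rewrite limf_einfE => fy FV.
have : (ereal_inf (f @` V) < y)%E.
  by apply: le_lt_trans fy; apply: ereal_sup_ubound; exists V.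
by move=> /ereal_inf_lt[_ [t Vt <-] ty]; exists t.
Qed.

Lemma limf_einf_le_near f F y : ProperFilter F ->
  (\forall t \near F, (f t <= y)%E) -> (limf_einf f F <= y)%E.
Proof.
move=> FF fy; rewrite limf_einfE; apply: ge_ereal_sup => _ [V FV <-].
have [t [Vt ty]] := filter_ex (filterI FV fy).
by apply: ereal_inf_le; exists (f t) => //; exists t.
Qed.

Lemma limf_einf_mono f g F : Filter F ->
  (\forall t \near F, (f t <= g t)%E) -> (limf_einf f F <= limf_einf g F)%E.
Proof.
move=> FF fg; rewrite !limf_einfE; apply: ge_ereal_sup => _ [V FV <-].
apply: (@le_trans _ _ (ereal_inf (g @` (V `&` [set t | (f t <= g t)%E])))).
  apply: le_ereal_inf_tmp => _ [t [Vt ft] <-].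
  by apply: le_trans ft; apply: ereal_inf_lbound; exists t.
apply: ereal_sup_ubound; exists (V `&` [set t | (f t <= g t)%E]) => //.
exact: filterI.
Qed.

End ExtendedReals.

Section HausdorffMeasure.
Context {R : realType} {d : nat}.
Implicit Types (A : set 'rV[R]_d) (s : R).

Lemma diam_pow_ge0 s A : (0 <= diam_pow s A)%E.
Proof. by rewrite /diam_pow; case: ifP => // _; exact: poweR_ge0. Qed.

Lemma diam_pow0 s : diam_pow s (set0 : set 'rV[R]_d) = 0%E.
Proof. by rewrite /diam_pow eqxx. Qed.

Lemma ediam0 : ediam (set0 : set 'rV[R]_d) = -oo%E.
Proof. by rewrite /ediam setX0 image_set0 ereal_sup0. Qed.

Lemma ediam_eball (x : 'rV[R]_d) (e : R) : (ediam (eball x e) <= (2 * e)%:E)%E.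
Proof.
apply: ge_ereal_sup => _ [[y z] /= [xy xz] <-]; rewrite lee_fin.
have := edist_triangle x y z; rewrite (edistC y x).
by move: xy xz; rewrite /eball /=; lra.
Qed.

Lemma diam_pow_le s A (e : R) : 0 <= s -> (ediam A <= e%:E)%E ->
  (diam_pow s A <= (e `^ s)%:E)%E.
Proof.
move=> s0 Ae; rewrite /diam_pow; case: eqP => [_|/eqP/set0P[x Ax]].
  by rewrite lee_fin powR_ge0.
have d0 : (0 <= ediam A)%E.
  by apply: ereal_sup_ubound; exists (x, x) => //=; rewrite edistxx.
move: d0 Ae; case: (ediam A) => [D| |]//=; rewrite !lee_fin => D0 De.
by apply: ge0_ler_powR; rewrite ?nnegrE// (le_trans D0).
Qed.

(** Null sets for the [s]-dimensional Hausdorff measure are stable under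
    countable unions; the hypothesis gives covers of total size as small as
    needed to spend [eta / 2 ^ n.+1] on the [n]-th set. *)
Lemma hausdorff_measure_bigcup0 s (A : nat -> set 'rV[R]_d) :
  (forall n (delta eta : R), 0 < delta -> 0 < eta ->
    exists2 U, delta_cover delta (A n) U &
      (\sum_(0 <= k <oo) diam_pow s (U k) <= eta%:E)%E) ->
  hausdorff_measure s (\bigcup_n A n) = 0%E.
Proof.
move=> H; apply/eqP; rewrite eq_le; apply/andP; split; last first.
  apply: (@le_trans _ _ (hausdorff_premeasure s 1 (\bigcup_n A n))).
    apply: le_ereal_inf_tmp => _ [U _ <-].
    by apply: nneseries_ge0 => k _ _; exact: diam_pow_ge0.
  by apply: ereal_sup_ubound; exists 1 => //=.
apply: ge_ereal_sup => _ [delta /= delta0 <-].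
apply/lee_addgt0Pr => eta eta0; rewrite add0e.
have eta2 n : 0 < eta / (2 ^ n.+1)%:R by rewrite divr_gt0// ltr0n expn_gt0.
have HU n : exists U, delta_cover delta (A n) U /\
    (\sum_(0 <= k <oo) diam_pow s (U k) <= (eta / (2 ^ n.+1)%:R)%:E)%E.
  by have [U ? ?] := H n delta _ delta0 (eta2 n); exists U.
have [U {}HU] := choice HU.
have /card_esym/ppcard_eqP[f] := card_nat2.
pose V k := U (f k).1 (f k).2.
apply: (@le_trans _ _ (\sum_(0 <= k <oo) diam_pow s (V k))%E).
  apply: ereal_inf_lbound; exists V => //; split.
    move=> x [n _ Anx]; have [[cov _] _] := HU n.
    have [k _ Ux] := cov x Anx; exists (f^-1%FUN (n, k)) => //.
    by rewrite /V invK ?inE.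
  by move=> k; have [[_ h] _] := HU (f k).1; exact: h.
pose h (z : nat * nat) := diam_pow s (U z.1 z.2).
rewrite nneseries_esumT; last by move=> k; exact: diam_pow_ge0.
rewrite -(@reindex_esum _ _ _ setT setT f h) ?bijTT//.
rewrite (_ : [set: nat * nat] = setT `*`` (fun=> setT)); last first.
  by apply/seteqP; split.
rewrite -(@esum_esum _ _ _ setT (fun=> setT) (fun n k => diam_pow s (U n k))); last first.
  by move=> *; exact: diam_pow_ge0.
rewrite -nneseries_esumT; last by move=> n; apply: esum_ge0 => *; exact: diam_pow_ge0.
apply: (@le_trans _ _ (\sum_(0 <= n <oo) (0 + (eta / (2 ^ n.+1)%:R)%:E))%E).
  apply: lee_nneseries => n _; first by move=> _; apply: esum_ge0 => *; exact: diam_pow_ge0.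
  rewrite add0e -nneseries_esumT; first by have [] := HU n.
  by move=> *; exact: diam_pow_ge0.
apply: le_trans (epsilon_trick _ _ _) _ => //; first exact: ltW.
by rewrite eseries0// add0e.
Qed.

End HausdorffMeasure.

(** * The Hausdorff spectrum is at most the coarse spectrum *)

(** In a maximal packing every further ball meets one of the chosen balls, so
    doubling the radius covers. *)
Lemma maximal_packing_cover {R : realType} {d : nat} (A : set 'rV[R]_d) (e : R) (B : nat) :
  (forall n (x : 'I_n -> 'rV[R]_d), (forall i, A (x i)) ->
    (forall i j, i != j -> eball (x i) e `&` eball (x j) e = set0) -> (n <= B)%N) ->
  exists n (x : 'I_n -> 'rV[R]_d), (n <= B)%N /\
    forall y, A y -> exists i, eball (x i) (2 * e) y.
Proof.
move=> HB.
pose P n := `[< exists x : 'I_n -> 'rV[R]_d, (forall i, A (x i)) /\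
  (forall i j, i != j -> eball (x i) e `&` eball (x j) e = set0) >].
have P0 : exists n, P n.
  by exists 0%N; apply/asboolP; exists (fun=> 0); split => -[].
have Pb n : P n -> (n <= B)%N by move=> /asboolP[x [Ax dx]]; exact: HB Ax dx.
case: (ex_maxnP P0 Pb) => n /asboolP[x [Ax dx]] nmax.
exists n, x; split; first exact: HB Ax dx.
move=> y Ay; apply: contrapT => far.
have dy i : eball (x i) e `&` eball y e = set0.
  apply/seteqP; split => // z [xz yz]; apply: far; exists i.
  have := edist_triangle z (x i) y; rewrite (edistC z).
  by move: xz yz; rewrite /eball /=; lra.
have : P n.+1; last by move=> /nmax; rewrite ltnn.
(* The packing enlarged by [y] at the last index. *)
pose x' (i : 'I_n.+1) := if unlift ord_max i is Some j then x j else y.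
apply/asboolP; exists x'; split => [i|i j ij]; first by rewrite /x'; case: unliftP.
rewrite /x'; case: unliftP ij => [i' ->|->]; case: unliftP => [j' ->|->] //.
- by rewrite (inj_eq lift_inj); exact: dx.
- by move=> _; rewrite setIC.
- by rewrite eqxx.
Qed.

Section CoarseSpectrum.
Context {R : realType} {d : nat} (mu : probability (borelRd R d) R).
Implicit Types (alpha rho e : R).

Lemma packing_number_ge alpha rho e n (x : 'I_n -> 'rV[R]_d) :
  packing_family mu alpha rho e x -> ((n%:R : R)%:E <= packing_number mu alpha rho e)%E.
Proof. by move=> H; apply: ereal_sup_ubound; exists n => //; exists x. Qed.

Lemma packing_number_ge0 alpha rho e : (0 <= packing_number mu alpha rho e)%E.
Proof. by apply: (@packing_number_ge _ _ _ 0 (fun=> 0)); split => -[]. Qed.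

Lemma coarse_spectrum_at_mono alpha rho rho' : rho <= rho' ->
  (coarse_spectrum_at mu alpha rho <= coarse_spectrum_at mu alpha rho')%E.
Proof.
move=> h; apply: limf_einf_mono; near=> e.
have [e0 le0] : 0 < e /\ 0 < - ln e by near: e; exact: near0_lt_neg_ln.
apply: lee_wpmul2r; first by rewrite lee_fin invr_ge0 ltW.
rewrite lee_lne ?in_itv/= ?leey ?packing_number_ge0//.
apply: ge_ereal_sup => _ [n [x [sx dx rx]] <-]; apply: packing_number_ge; split => //.
by move=> i; have /andP[h1 h2] := rx i; apply/andP; lra.
Unshelve. all: by end_near. Qed.

Lemma coarse_spectrum_cvg alpha :
  cvg (coarse_spectrum_at mu alpha rho @[rho --> (0 : R)^'+]).
Proof.
apply: nondecreasing_at_right_is_cvge; apply: nearW => y a b _ _.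
exact: coarse_spectrum_at_mono.
Qed.

Lemma coarse_spectrum_ge alpha (y : \bar R) :
  (forall rho, 0 < rho -> (y <= coarse_spectrum_at mu alpha rho)%E) ->
  (y <= coarse_spectrum mu alpha)%E.
Proof.
move=> H; apply: lime_ge; first exact: coarse_spectrum_cvg.
by near=> rho; apply: H.
Unshelve. all: by end_near. Qed.

Lemma coarse_spectrum_le alpha rho (y : \bar R) : 0 < rho ->
  (coarse_spectrum_at mu alpha rho <= y)%E -> (coarse_spectrum mu alpha <= y)%E.
Proof.
move=> rho0 H; apply: lime_le; first exact: coarse_spectrum_cvg.
near=> rho'; apply: le_trans H; apply: coarse_spectrum_at_mono; apply/ltW.
by near: rho'; exact: nbhs_right_lt.
Unshelve. all: by end_near. Qed.

(** The scale from which the exponent is controlled is measured by [- ln e]. *)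
Let level alpha rho n : set 'rV[R]_d := [set x | measure_support mu x /\
  forall e, 0 < e -> n%:R < - ln e -> alpha - rho <= log_ratio mu x e <= alpha + rho].

(** Points whose ball masses have nearly the exponent [alpha] from a fixed scale
    on are covered by the doubled balls of a maximal packing, so their
    Hausdorff dimension is at most the growth rate of the packing numbers. *)
Lemma spectrum_le_coarse_at alpha rho : 0 < rho ->
  (multifractal_spectrum mu alpha <= coarse_spectrum_at mu alpha rho)%E.
Proof.
move=> rho0; rewrite /multifractal_spectrum /hausdorff_dim; set X := [set x | _].
case: eqP => [_|/eqP/set0P X0]; first exact: leNye.
apply: le_of_lt_real => s /exists_real_between[s1 /andP[cs1 s1s]].
rewrite lte_fin in s1s.
have freq (V : set R) : (0 : R)^'+ V -> exists2 e, V e &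
   forall n (x : 'I_n -> 'rV[R]_d), packing_family mu alpha rho e x -> (0 < n)%N ->
     ln n%:R <= s1 * - ln e.
  move=> FV.
  have [e [Ve [e0 le0]] He] := limf_einf_lt _ _ _ _ cs1 (filterI FV (near0_lt_neg_ln 0)).
  exists e => // n x /packing_number_ge px n0.
  rewrite -ler_pdivrMr// -lee_fin; apply: le_trans (ltW He).
  rewrite EFinM; apply: lee_wpmul2r; first by rewrite lee_fin invr_ge0 ltW.
  rewrite -lne_EFin ?ltr0n// lee_lne ?in_itv/= ?leey ?packing_number_ge0 ?lee_fin ?ler0n//.
have Xlevel : X = \bigcup_n (X `&` level alpha rho n).
  apply/seteqP; split => [x Xx|x [n _ []]//]; case: (Xx) => sx cx.
  move/cvgrPdist_le : cx => /(_ _ rho0) [eps /= eps0 Heps].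
  exists (Num.truncn (- ln eps)).+1 => //; split => //; split => // e e0 ne.
  have := Heps e; rewrite /ball_ /= sub0r normrN gtr0_norm//.
  have eeps : e < eps.
    rewrite -ltr_ln ?posrE// -ltrN2; apply: lt_trans ne.
    exact: truncnS_gt.
  by move=> /(_ eeps e0); rewrite ler_distl => /andP[h1 h2]; apply/andP; lra.
have level_family n e m (x : 'I_m -> 'rV[R]_d) : 0 < e -> n%:R < - ln e ->
    (forall i, (X `&` level alpha rho n) (x i)) ->
    (forall i j, i != j -> eball (x i) e `&` eball (x j) e = set0) ->
    packing_family mu alpha rho e x.
  by move=> e0 ne lx dx; split => // i; have [[sx _] [_ h]] := lx i; [exact: sx|exact: h].
have s0 : 0 <= s.
  have [x Xx] := X0; move: (Xx); rewrite {1}Xlevel => -[n _ [_ [sx lx]]].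
  have [e [e0 ne] He] := freq _ (near0_lt_neg_ln n%:R).
  have le0 : 0 < - ln e by apply: le_lt_trans ne.
  have := He 1%N (fun=> x); rewrite ln1 pmulr_lge0// => h.
  apply: le_trans (ltW s1s); apply: h => //.
  apply: (level_family n) => //; last by move=> i j; rewrite !ord1.
suff Hs : hausdorff_measure s X = 0%E by apply: ereal_inf_lbound; exists s.
rewrite Xlevel; apply: hausdorff_measure_bigcup0 => n delta eta delta0 eta0.
have [e [[e0 ne] [_ De]] He] := freq _ (filterI (near0_lt_neg_ln n%:R)
  (near0_lt_neg_ln (Num.max (ln 4 - ln delta) ((s * ln 4 - ln eta) / (s - s1))))).
move: De; rewrite gt_max => /andP[D1 D2].
have D0 : 0 < - ln e by apply: le_lt_trans ne.
set D := - ln e in ne D1 D2 D0 He *.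
have bnd m (x : 'I_m -> 'rV[R]_d) : (forall i, (X `&` level alpha rho n) (x i)) ->
    (forall i j, i != j -> eball (x i) e `&` eball (x j) e = set0) ->
    m%:R <= expR (s1 * D).
  move=> lx dx; case: m x lx dx => [|m] x lx dx; first exact: expR_ge0.
  by rewrite -[leLHS]lnK ?posrE// ler_expR (He m.+1 x)//; exact: (level_family n).
have bnd' m (x : 'I_m -> 'rV[R]_d) : (forall i, (X `&` level alpha rho n) (x i)) ->
    (forall i j, i != j -> eball (x i) e `&` eball (x j) e = set0) ->
    (m <= Num.truncn (expR (s1 * D)))%N.
  by move=> lx dx; rewrite truncn_ge_nat ?expR_ge0//; exact: bnd lx dx.
have [m [x [mB cov]]] := maximal_packing_cover _ _ _ bnd'.
pose U i := if insub i is Some j then eball (x j) (2 * e) else set0.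
have e4 : 4 * e <= delta.
  rewrite -ler_ln ?posrE ?mulr_gt0// lnM ?posrE//.
  by move: D1; rewrite /D; lra.
have dU i : (ediam (U i) <= (4 * e)%:E)%E.
  rewrite /U; case: insubP => [j _ _|_]; last by rewrite ediam0 leNye.
  by apply: le_trans (ediam_eball _ _) _; rewrite lee_fin; lra.
exists U.
  split; last by move=> i; apply: le_trans (dU i) _; rewrite lee_fin.
  move=> y /cov[j yj]; exists j => //; rewrite /U insubT//= => jm.
  by rewrite (_ : Sub _ _ = j)//; exact: val_inj.
rewrite (@nneseries_split _ _ 0 m)//; last by move=> *; exact: diam_pow_ge0.
rewrite add0n eseries0 ?adde0; last first.
  move=> i mi _; rewrite /U; case: insubP => [j|_]; last exact: diam_pow0.
  by move: mi; rewrite leqNgt => /negbTE->.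
apply: (@le_trans _ _ (\sum_(0 <= i < m) ((4 * e) `^ s)%:E)%E).
  by apply: lee_sum => i _; apply: diam_pow_le.
rewrite sumEFin lee_fin big_const_nat subn0 iter_addr addr0 -[leLHS]mulr_natl.
apply: (@le_trans _ _ (expR (s1 * D) * (4 * e) `^ s)).
  rewrite ler_wpM2r ?powR_ge0//.
  by rewrite -truncn_ge_nat ?expR_ge0.
have e40 : 0 < 4 * e by rewrite mulr_gt0.
rewrite (powR_expR _ _ e40) -expRD -[leRHS]lnK ?posrE// ler_expR lnM ?posrE//.
move: D2; rewrite ltr_pdivrMr ?subr_gt0// -/D => D2.
have -> : ln e = - D by rewrite opprK.
rewrite -subr_ge0 (_ : _ - _ = D * (s - s1) - (s * ln 4 - ln eta)); last by ring.
by rewrite subr_ge0 ltW.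
Qed.

Lemma multifractal_le_coarse alpha :
  (multifractal_spectrum mu alpha <= coarse_spectrum mu alpha)%E.
Proof. by apply: coarse_spectrum_ge => rho; exact: spectrum_le_coarse_at. Qed.

End CoarseSpectrum.

(** * Exponents of words and classes of equal composition *)

Section LogRatios.
Context {R : realType} {N : nat} {r p : 'I_N.+1 -> R}.
Context (r01 : forall i, 0 < r i < 1) (p_gt0 : forall i, 0 < p i).
Implicit Types (u v w : seq 'I_N.+1) (alpha : R) (I : set R).
Local Notation rw := (word_prod r).
Local Notation pw := (word_prod p).

Let r_gt0 i : 0 < r i. Proof. by have /andP[] := r01 i. Qed.
Let rw_gt0 w : 0 < rw w. Proof. exact: word_prod_gt0. Qed.
Let pw_gt0 w : 0 < pw w. Proof. exact: word_prod_gt0. Qed.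

Definition depth w : R := - ln (rw w).

(** Comparing the quotient of logarithms of [w] with [alpha] amounts to the sign of
    this quantity, which unlike the quotient is additive in [w]. *)
Definition excess alpha w : R := alpha * ln (rw w) - ln (pw w).

Lemma depth_cat u v : depth (u ++ v) = depth u + depth v.
Proof. by rewrite /depth word_prod_cat lnM ?posrE// opprD. Qed.

Lemma excess_cat alpha u v : excess alpha (u ++ v) = excess alpha u + excess alpha v.
Proof. by rewrite /excess !word_prod_cat !lnM ?posrE//; ring. Qed.

Lemma depth_nil : depth [::] = 0.
Proof. by rewrite /depth word_prod_nil ln1 oppr0. Qed.

Lemma excess_nil alpha : excess alpha [::] = 0.
Proof. by rewrite /excess !word_prod_nil ln1 mulr0 subrr. Qed.

Lemma depth_flatten (s : seq (seq 'I_N.+1)) : depth (flatten s) = \sum_(w <- s) depth w.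
Proof.
by elim: s => [|w s IH]; rewrite ?big_nil ?depth_nil// big_cons /= depth_cat IH.
Qed.

Lemma excess_flatten alpha (s : seq (seq 'I_N.+1)) :
  excess alpha (flatten s) = \sum_(w <- s) excess alpha w.
Proof.
by elim: s => [|w s IH]; rewrite ?big_nil ?excess_nil// big_cons /= excess_cat IH.
Qed.

Lemma depth_nseq n i : depth (nseq n i) = n%:R * depth [:: i].
Proof.
elim: n => [|n IH]; first by rewrite depth_nil mul0r.
by rewrite /= -cat1s depth_cat IH -natr1; ring.
Qed.

Lemma excess_nseq alpha n i : excess alpha (nseq n i) = n%:R * excess alpha [:: i].
Proof.
elim: n => [|n IH]; first by rewrite excess_nil mul0r.
by rewrite /= -cat1s excess_cat IH -natr1; ring.
Qed.

Lemma depth_ge0 w : 0 <= depth w.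
Proof.
rewrite oppr_ge0 ln_le0//; apply: prodr_ile1 => i _.
by have /andP[/ltW-> /ltW->] := r01 i.
Qed.

Lemma depth_gt0 w : w != [::] -> 0 < depth w.
Proof.
case: w => // i w _; rewrite -cat1s depth_cat ltr_pwDl ?depth_ge0//.
rewrite oppr_gt0 word_prod_cons word_prod_nil mulr1 ln_lt0//; exact: r01.
Qed.

Lemma powR_rw w (t : R) : rw w `^ t = expR (- (t * depth w)).
Proof. by rewrite powR_expR// /depth mulrN opprK. Qed.

Lemma ln_ratio_sub alpha w : w != [::] ->
  ln (pw w) / ln (rw w) - alpha = excess alpha w / depth w.
Proof.
move=> /depth_gt0; rewrite /excess /depth oppr_gt0 => d0.
by field; rewrite lt_eqF.
Qed.

Lemma excess_gt0 alpha i : (0 < excess alpha [:: i]) = (alpha < ln (p i) / ln (r i)).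
Proof.
have w0 : [:: i] != [::] by [].
have := ln_ratio_sub alpha _ w0; rewrite !word_prod_cons !word_prod_nil !mulr1 => h.
by rewrite -[RHS]subr_gt0 h pmulr_lgt0// invr_gt0 depth_gt0.
Qed.

Lemma excess_lt0 alpha i : (excess alpha [:: i] < 0) = (ln (p i) / ln (r i) < alpha).
Proof.
have w0 : [:: i] != [::] by [].
have := ln_ratio_sub alpha _ w0; rewrite !word_prod_cons !word_prod_nil !mulr1 => h.
by rewrite -[RHS]subr_lt0 h pmulr_llt0// invr_gt0 depth_gt0.
Qed.

(** From any exponent [alpha] in [I] one can move a little inside [I] by
    appending copies of a suitable letter: upwards with a letter of exponent
    above [alpha], or downwards with one of exponent below. *)
Lemma exists_steering_letter I alpha : is_interval I ->
  (interior I `&` `]min_over (fun i => ln (p i) / ln (r i)),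
         max_over (fun i => ln (p i) / ln (r i))[) !=set0 ->
  I alpha ->
  exists (j : 'I_N.+1) (e kappa : R), [/\ `|e| = 1, 0 < kappa,
    0 < e * excess alpha [:: j] &
    forall w, w != [::] -> 0 <= e * excess alpha w <= kappa * depth w ->
      I (ln (pw w) / ln (rw w))].
Proof.
move=> itvI [a1 [Ia1]]; rewrite /= in_itv/= => /andP[mina maxa] Ialpha.
have [le1|lt1] := leP alpha a1.
  have [a2 a12 Ia2] : exists2 a2, alpha < a2 & I a2.
    move: le1; rewrite le_eqVlt => /predU1P[->|lt1]; last first.
      by exists a1 => //; exact: interior_subset Ia1.
    have /nbhs_ballP[e /= e0 eI] := Ia1.
    exists (a1 + e / 2); first by rewrite ltrDl divr_gt0.
    apply: eI; rewrite -ball_normE /ball_ /= opprD addrA subrr sub0r normrN.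
    by rewrite gtr0_norm ?divr_gt0// ltr_pdivrMr// mulr_natr mulr2n ltrDl.
  have [j jmax] : exists j, alpha < ln (p j) / ln (r j).
    apply: contrapT => no; move: maxa; apply/negP; rewrite -leNgt.
    have h i : ln (p i) / ln (r i) <= a1.
      by apply: le_trans le1; rewrite leNgt; apply/negP => h; apply: no; exists i.
    by apply: bigmax_le => // i _; exact: h.
  exists j, 1, (a2 - alpha); split; rewrite ?normr1 ?subr_gt0 ?mul1r ?excess_gt0//.
  move=> w w0; rewrite mul1r => /andP[h1 h2]; have d0 := depth_gt0 _ w0.
  apply: (itvI alpha a2) => //; apply/andP; split.
    by rewrite -subr_ge0 ln_ratio_sub// divr_ge0// ltW.
  by rewrite -(lerD2r (- alpha)) ln_ratio_sub// ler_pdivrMr.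
have [j jmin] : exists j, ln (p j) / ln (r j) < alpha.
  apply: contrapT => no; move: mina; apply/negP; rewrite -leNgt.
  have h i : a1 <= ln (p i) / ln (r i).
    by apply: le_trans (ltW lt1) _; rewrite leNgt; apply/negP => h; apply: no; exists i.
  by apply: le_bigmin => // i _; exact: h.
exists j, (-1), (alpha - a1); split.
- by rewrite normrN1.
- by rewrite subr_gt0.
- by rewrite mulN1r oppr_gt0 excess_lt0.
move=> w w0; rewrite mulN1r => /andP[h1 h2]; have d0 := depth_gt0 _ w0.
apply: (itvI a1 alpha) => //; first exact: interior_subset Ia1.
apply/andP; split; last first.
  by rewrite -subr_le0 ln_ratio_sub// pmulr_lle0 ?invr_gt0// -oppr_ge0.
rewrite -(lerD2r (- alpha)) ln_ratio_sub// ler_pdivlMr//.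
by rewrite -[alpha - a1]opprB mulNr lerN2 in h2.
Qed.

End LogRatios.
Arguments depth {R N} r w.
Arguments excess {R N} r p alpha w.

Section CompositionClasses.
Context {R : realType} {N : nat} {r : 'I_N.+1 -> R}.
Context (r01 : forall i, 0 < r i < 1).
Implicit Types (w : seq 'I_N.+1) (D : set (seq 'I_N.+1)) (t s : R).
Local Notation rw := (word_prod r).

Let r_gt0 i : 0 < r i. Proof. by have /andP[] := r01 i. Qed.
Let rw_gt0 w : 0 < rw w. Proof. exact: word_prod_gt0. Qed.

Lemma word_prod_count (a : 'I_N.+1 -> R) w :
  word_prod a w = \prod_i a i ^+ count_mem i w.
Proof.
elim: w => [|j w IH]; first by rewrite word_prod_nil big1.
rewrite word_prod_cons IH /= (bigD1 j)//= [RHS](bigD1 j)//= eqxx exprS mulrA.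
congr (_ * _); apply: eq_bigr => i ij.
by rewrite eq_sym (negbTE ij).
Qed.

Lemma geometric_sum_le (c : R) m : 0 < c < 1 -> \sum_(i < m) c ^+ i <= (1 - c)^-1.
Proof.
move=> /andP[c0 c1]; have d0 : 0 < 1 - c by rewrite subr_gt0.
rewrite -[leRHS]mul1r ler_pdivlMr// mulrC -[1 - c]opprB mulNr -subrX1 opprB.
by rewrite gerBl exprn_ge0// ltW.
Qed.

Lemma powR_prod (a : 'I_N.+1 -> R) t : (forall i, 0 <= a i) ->
  (\prod_i a i) `^ t = \prod_i a i `^ t.
Proof.
move=> a0; have [] // : 0 <= \prod_i a i /\ (\prod_i a i) `^ t = \prod_i a i `^ t.
apply: (big_ind2 (fun y z => 0 <= y /\ y `^ t = z)) => [|y1 y2 z1 z2 [h1 <-] [h2 <-]|i _].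
- by rewrite powR1.
- by rewrite mulr_ge0// powRM.
- by rewrite a0.
Qed.

(** Group words by how often each letter occurs.  If every class [F] satisfied
    [(size F)%:R * rw w0 `^ t < 1], the sum of [rw w `^ s] would be at most the sum
    of [rw w `^ (s - t)] over one word per class, which is a product of
    geometric series and hence finite. *)
Lemma exists_large_composition_class D s t : t < s ->
  ~ summable D (fun w => (rw w `^ s)%:E) ->
  exists (w0 : seq 'I_N.+1) (F : seq (seq 'I_N.+1)), [/\ w0 \in F, uniq F,
    {in F, forall w, D w /\ perm_eq w w0} & 1 <= (size F)%:R * rw w0 `^ t].
Proof.
move=> ts nsum; apply: contrapT => no; apply: nsum.
pose c i := r i `^ (s - t).
have c01 i : 0 < c i < 1.
  by rewrite powR_gt0//= powR_lt1 ?subr_gt0// r01.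
suff bnd (L : seq (seq 'I_N.+1)) : uniq L -> {in L, forall w, D w} ->
    \sum_(w <- L) rw w `^ s <= \prod_i (1 - c i)^-1.
  rewrite /summable; apply: (@le_lt_trans _ _ (\prod_i (1 - c i)^-1)%:E); last exact: ltry.
  apply: ge_ereal_sup => _ [X [finX XD] <-].
  rewrite fsbig_finite//= (eq_bigr (fun w => (rw w `^ s)%:E)) ?sumEFin ?lee_fin.
    apply: bnd => [|w]; first exact: finmap.fset_uniq.
    by move=> wX; apply: XD; move: wX; rewrite [_ \in _]in_fset_set// inE.
  by move=> w _; rewrite ger0_norm// powR_ge0.
move=> uL LD.
pose m := (\max_(w <- L) size w).+1.
have szm w : w \in L -> (size w < m)%N.
  by move=> wL; rewrite ltnS (big_rem w)//= leq_maxl.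
pose cls w : {ffun 'I_N.+1 -> 'I_m} := [ffun i => inord (count_mem i w)].
have clsE w i : w \in L -> cls w i = count_mem i w :> nat.
  move=> wL; rewrite ffunE inordK//; exact: leq_ltn_trans (count_size _ _) (szm w wL).
rewrite (partition_big cls predT)//=.
apply: (@le_trans _ _ (\sum_(f : {ffun 'I_N.+1 -> 'I_m}) \prod_i c i ^+ f i)).
  apply: ler_sum => f _; rewrite -big_filter; set F := [seq w <- L | _].
  have cf0 : 0 <= \prod_i c i ^+ f i.
    by apply: prodr_ge0 => i _; rewrite exprn_ge0// powR_ge0.
  have [->|F0] := eqVneq F [::]; first by rewrite big_nil.
  have [w0 w0F] : exists w0, w0 \in F.
    by case E : F F0 => [//|w0 F'] _; exists w0; rewrite mem_head.
  have FL w : w \in F -> w \in L /\ cls w = f.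
    by rewrite mem_filter => /andP[/eqP].
  have Fperm w : w \in F -> perm_eq w w0.
    move=> wF; have [wL wf] := FL w wF; have [w0L w0f] := FL w0 w0F.
    by apply/allP => i _ /=; rewrite -!clsE// wf w0f.
  have Frw w : w \in F -> rw w = rw w0 by move=> /Fperm h; exact: perm_big.
  have small : (size F)%:R * rw w0 `^ t < 1.
    rewrite ltNge; apply/negP => h; apply: no; exists w0, F; split => //.
      by rewrite filter_uniq.
    by move=> w wF; split; [apply: LD; case: (FL w wF)|exact: Fperm].
  rewrite (eq_big_seq (fun=> rw w0 `^ s)); last by move=> w /Frw->.
  rewrite big_const_seq count_predT iter_addr addr0 -[leLHS]mulr_natl.
  have -> : \prod_i c i ^+ f i = rw w0 `^ (s - t).
    rewrite (word_prod_count _ w0) powR_prod//; last by move=> i; exact: exprn_ge0 (ltW (r_gt0 i)).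
    apply: eq_bigr => i _; have [w0L <-] := FL w0 w0F; rewrite clsE//.
    by rewrite /c -powR_mulrn ?powR_ge0// -(powR_mulrn _ (ltW (r_gt0 i))) -!powRrM mulrC.
  have -> : rw w0 `^ s = rw w0 `^ t * rw w0 `^ (s - t).
    rewrite -powRD; first by rewrite addrC subrK.
    by rewrite (gt_eqF (rw_gt0 w0)) implybT.
  by rewrite mulrA ler_piMl ?powR_ge0// ltW.
rewrite -(bigA_distr_bigA (fun i (j : 'I_m) => c i ^+ j)).
apply: ler_prod => i _; apply/andP; split.
  by apply: sumr_ge0 => j _; rewrite exprn_ge0// powR_ge0.
exact: geometric_sum_le.
Qed.

End CompositionClasses.

(** * The abscissa is at most the supremum of the Hausdorff spectrum *)

Lemma exists_nat_mul_ge {R : realType} (x y : R) : 0 < y ->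
  exists2 n : nat, (0 < n)%N & forall m, (n <= m)%N -> x <= m%:R * y.
Proof.
move=> y0; exists (Num.truncn (x / y)).+1 => // m nm.
rewrite -ler_pdivrMr//; apply/ltW; apply: lt_le_trans (truncnS_gt _) _.
by rewrite ler_nat.
Qed.

Lemma cat_eq_prefix {T : eqType} (u v s t : seq T) : u ++ s = v ++ t ->
  prefix u v \/ prefix v u.
Proof.
move=> E; case: (leqP (size u) (size v)) => [uv|/ltnW vu]; [left|right]; apply/prefixP.
- exists (drop (size u) v); rewrite -{1}(take_size_cat s (erefl (size u))) E.
  by rewrite takel_cat// cat_take_drop.
- exists (drop (size v) u); rewrite -{1}(take_size_cat t (erefl (size v))) -E.
  by rewrite takel_cat// cat_take_drop.
Qed.

(** Unique decoding of a prefix-free code, also in front of arbitrary tails. *)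
Lemma prefix_free_flatten_inj {T : eqType} (P : seq T -> Prop) :
  (forall u v, P u -> P v -> prefix u v -> u = v) ->
  forall c c' z z', {in c, forall u, P u} -> {in c', forall u, P u} ->
    size c = size c' -> flatten c ++ z = flatten c' ++ z' -> c = c'.
Proof.
move=> pf; elim=> [|u c IH] [|u' c'] z z' //= Pc Pc' [sc]; rewrite -!catA => E.
have Pu : P u by apply: Pc; rewrite mem_head.
have Pu' : P u' by apply: Pc'; rewrite mem_head.
have uu' : u = u'.
  by case: (cat_eq_prefix _ _ _ _ E) => h; [exact: pf|apply/esym; exact: pf].
move: E; rewrite uu' => /(congr1 (drop (size u'))); rewrite !drop_size_cat// => E.
congr (_ :: _); apply: IH sc E => w wc.
- by apply: Pc; rewrite inE wc orbT.
- by apply: Pc'; rewrite inE wc orbT.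
Qed.

Section AbscissaLower.
Context {R : realType} {d N : nat}.
Context {S : 'I_N.+1 -> 'rV[R]_d.+1 -> 'rV[R]_d.+1} {r p : 'I_N.+1 -> R}.
Context (r01 : forall i, 0 < r i < 1).
Context (S_sim : forall i, similarity (r i) (S i)).
Context (p_gt0 : forall i, 0 < p i) (p_sum : \sum_i p i = 1).
Context {mu : probability (borelRd R d.+1) R}.
Context (mu_ss : self_similar_measure mu p S) (S_osc : open_set_condition S).
Local Notation rw := (word_prod r).
Local Notation pw := (word_prod p).

Let r_gt0 i : 0 < r i. Proof. by have /andP[] := r01 i. Qed.
Let rw_gt0 w : 0 < rw w. Proof. exact: word_prod_gt0. Qed.
Let pw_gt0 w : 0 < pw w. Proof. exact: word_prod_gt0. Qed.

Lemma uniform_words_spectrum_ge (v : seq 'I_N.+1) (M : nat) (Q : R) :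
  0 < Q -> (forall i, edist (S i 0) 0 + r i * Q <= Q) -> mu (eball 0 Q) = 1%E ->
  (forall w x (e : R), cyl S r Q (w ++ v) x ->
     0 < e <= rw (w ++ v) -> fine (mu (eball x e)) <= M%:R * pw w) ->
  forall (L : seq (seq 'I_N.+1)) w1 (t : R), w1 != [::] -> w1 \in L -> uniq L ->
  {in L, forall w, [/\ size w = size w1, rw w = rw w1, pw w = pw w1 &
     exists u, w = u ++ v]} ->
  1 <= (size L)%:R * rw w1 `^ t ->
  (t%:E <= multifractal_spectrum mu (ln (pw w1) / ln (rw w1)))%E.
Proof.
move=> Q0 Qinv muQ vsep L w1 t w1n w1L uL HL kt.
have sL : (0 < size L)%N by case: (L) w1L.
pose k := (size L).-1; have kE : k.+1 = size L by rewrite prednK.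
pose W (j : 'I_k.+1) := nth [::] L j.
have jL (j : 'I_k.+1) : (j < size L)%N by rewrite -kE.
have WL j : W j \in L by rewrite mem_nth.
have W_inj : injective W.
  by move=> i j /eqP; rewrite nth_uniq// => /eqP h; exact: val_inj.
have rw1 : rw w1 < 1.
  have := depth_gt0 r01 _ w1n; rewrite /depth oppr_gt0 -{1}(ln1 R).
  by rewrite ltr_ln// posrE.
apply: (homogeneous_spectrum_ge r01 S_sim p_gt0 p_sum mu_ss S_osc Q0 Qinv muQ vsep
  W_inj (l := size w1) (q := pw w1) (rho := rw w1)) => //.
- by move=> j; have [] := HL _ (WL j).
- by move=> j; have [] := HL _ (WL j).
- by move=> j; have [] := HL _ (WL j).
- by move=> j; have [] := HL _ (WL j).
- by rewrite kE.
Qed.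

(** Divergence of the zeta function at [s] yields many words of the same
    composition, hence with a common exponent in [I].  Blocks of [m] of these words,
    followed by a fixed tail that steers the exponent back into [I] and ends in
    a separating word, generate a homogeneous subsystem; for large [m] the tail
    costs little. *)
Lemma abscissa_le_sup_spectrum (I : set R) : is_interval I ->
  (interior I `&` `]min_over (fun i => ln (p i) / ln (r i)),
         max_over (fun i => ln (p i) / ln (r i))[) !=set0 ->
  (abscissa_zeta_sim r p I
    <= ereal_sup [set multifractal_spectrum mu alpha | alpha in I])%E.
Proof.
move=> itvI meetsI; rewrite leNgt; apply/negP.
move=> /exists_real_between[t' /andP[supt /exists_real_between[s /andP[ts sab]]]].
rewrite lte_fin in ts; pose t := (t' + s) / 2.
have t't : t' < t by rewrite /t; lra.
have {}ts : t < s by rewrite /t; lra.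
have nsum : ~ summable (zeta_words r p I) (fun w => (rw w `^ s)%:E).
  move=> sm; move: sab; apply/negP; rewrite -leNgt.
  by apply: ereal_inf_lbound; exists s.
have [w0 [F [w0F uF HF sF]]] := exists_large_composition_class r01 _ _ _ ts nsum.
have [[w0n Iw0] _] := HF _ w0F.
pose alpha := ln (pw w0) / ln (rw w0).
have d0 : 0 < depth r w0 by exact: depth_gt0.
have ex0 : excess r p alpha w0 = 0.
  apply/eqP; have := ln_ratio_sub r01 (p := p) alpha _ w0n; rewrite subrr.
  by move/esym/eqP; rewrite mulf_eq0 invr_eq0 (gt_eqF d0) orbF.
have [j [e [kappa [e1 kappa0 ej HI]]]] :=
  exists_steering_letter r01 _ _ itvI meetsI Iw0.
rewrite -/alpha in ej HI.
have [Q [Q0 Qinv muQ]] := exists_invariant_ball r01 S_sim p_gt0 p_sum mu_ss.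
have [v [M vsep]] :=
  exists_separating_word r01 S_sim p_gt0 p_sum mu_ss Q0 muQ S_osc.
(* [n] letters [j] outweigh the excess of the separating word [v]. *)
have [n n0 Hn] := exists_nat_mul_ge `|excess r p alpha v| _ ej.
pose z := nseq n j ++ v.
have ez : 0 <= e * excess r p alpha z.
  rewrite /z excess_cat// excess_nseq// mulrDr mulrCA.
  have := Hn n (leqnn n); have := ler_norm (- (e * excess r p alpha v)).
  by rewrite normrN normrM e1 mul1r; lra.
(* [m1] repetitions keep the exponent in [I]; [m2] make up for the loss in the
   growth rate caused by the tail. *)
have [m1 _ Hm1] := exists_nat_mul_ge (e * excess r p alpha z) _ (mulr_gt0 kappa0 d0).
have dt0 : 0 < (t - t') * depth r w0 by rewrite mulr_gt0// subr_gt0.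
have [m2 m20 Hm2] := exists_nat_mul_ge (t' * depth r z) _ dt0.
pose m := (m1 + m2)%N.
have {}Hm1 := Hm1 m (leq_addr _ _).
have {}Hm2 := Hm2 m (leq_addl _ _).
pose L := [seq flatten c ++ z | c <- all_lists F m].
have szF w : w \in F -> size w = size w0 by move=> /HF[_ /perm_size].
have uL : uniq L.
  rewrite map_inj_in_uniq ?all_lists_uniq// => c c' /mem_all_lists[sc cF] /mem_all_lists[sc' c'F].
  apply: (prefix_free_flatten_inj (fun w => size w = size w0)).
  - move=> u u' su su' /prefixP[x xE]; have := congr1 size xE.
    rewrite size_cat su su' -[LHS]addn0 => /addnI/esym/size0nil x0.
    by rewrite xE x0 cats0.
  - by move=> u /cF /szF.
  - by move=> u /c'F /szF.
  - by rewrite sc sc'.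
have LP w : w \in L -> [/\ size w = (m * size w0 + size z)%N,
    rw w = rw w0 ^+ m * rw z, pw w = pw w0 ^+ m * pw z &
    exists u, w = u ++ v].
  move=> /mapP[c /mem_all_lists[<- cF] ->].
  have cE (a : 'I_N.+1 -> R) : word_prod a (flatten c) = word_prod a w0 ^+ size c.
    elim: c cF => [|x c IH] cF; first by rewrite /= word_prod_nil.
    rewrite /= word_prod_cat IH; last by move=> y yc; apply: cF; rewrite inE yc orbT.
    have /HF[_ xw] : x \in F by apply: cF; rewrite mem_head.
    by rewrite exprS; congr (_ * _); exact: perm_big.
  rewrite !word_prod_cat !cE; split => //; last by exists (flatten c ++ nseq n j); rewrite -catA.
  rewrite size_cat; congr (_ + _)%N.
  elim: c cF {cE} => //= x c IH cF; rewrite size_cat IH; last first.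
    by move=> y yc; apply: cF; rewrite inE yc orbT.
  by rewrite szF ?mem_head ?mulSn// cF ?mem_head.
pose w1 := flatten (nseq m w0) ++ z.
have w1L : w1 \in L.
  apply/map_f; elim: (m) => [|m' IH]; first by rewrite mem_head.
  by apply/allpairsPdep; exists w0, (nseq m' w0).
have [_ rw1 pw1 _] := LP _ w1L.
have w1n : w1 != [::].
  rewrite -size_eq0; have [-> _ _ _] := LP _ w1L.
  have m_gt0 : (0 < m)%N by rewrite addn_gt0 m20 orbT.
  have w0_gt0 : (0 < size w0)%N by rewrite lt0n size_eq0.
  by rewrite -lt0n addn_gt0 muln_gt0 m_gt0 w0_gt0.
have depth1 : depth r w1 = m%:R * depth r w0 + depth r z.
  rewrite /depth rw1 lnM ?posrE ?exprn_gt0// lnXn// -[X in - (X + _)]mulr_natl; ring.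
have excess1 : excess r p alpha w1 = excess r p alpha z.
  rewrite /w1 excess_cat// excess_flatten// big1_seq ?add0r// => w /= /nseqP[-> _].
  exact: ex0.
have dz0 := depth_ge0 r01 z.
have Iw1 : I (ln (pw w1) / ln (rw w1)).
  apply: HI => //; rewrite excess1 ez /= depth1; apply: le_trans Hm1 _.
  by rewrite mulrCA ler_pM2l// lerDl.
move: supt; apply/negP; rewrite -leNgt.
apply: (@le_trans _ _ (multifractal_spectrum mu (ln (pw w1) / ln (rw w1)))); last first.
  by apply: ereal_sup_ubound; exists (ln (pw w1) / ln (rw w1)).
apply: (uniform_words_spectrum_ge _ _ _ Q0 Qinv muQ vsep L) => // [w wL|].
  by have [-> -> -> ?] := LP _ wL; have [-> -> -> _] := LP _ w1L; split.
rewrite size_map size_all_lists natrX.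
have sF0 : 0 < (size F)%:R :> R by rewrite ltr0n; case: (F) w0F.
rewrite -[_%:R](lnK _) ?posrE// -expRM_natl powR_rw// -expRD -[leLHS]expR0 ler_expR depth1.
move: sF; rewrite powR_rw// -{1}[_%:R](lnK _) ?posrE// -expRD -[leLHS]expR0 ler_expR => sF.
have : 0 <= m%:R * (ln (size F)%:R - t * depth r w0).
  by rewrite mulr_ge0//; move: sF; lra.
move=> h; rewrite (_ : _ - _ = m%:R * (ln (size F)%:R - t * depth r w0) +
  (m%:R * ((t - t') * depth r w0) - t' * depth r z)); last by ring.
by rewrite addr_ge0 ?subr_ge0.
Qed.

End AbscissaLower.

(** * Mixing words of large and small exponent *)

Lemma exists_fiber_representatives {T : eqType} (n M : nat) (f : 'I_n -> T) :
  (forall i0, (#|[pred i | f i == f i0]| <= M)%N) ->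
  exists J : seq 'I_n, [/\ uniq J, {in J &, injective f} & (n <= M * size J)%N].
Proof.
move=> HM.
pose rep i := [arg min_(j < i | f j == f i) (j : nat)].
have repP i : f (rep i) = f i /\ forall j, f j = f i -> (rep i <= j)%N.
  rewrite /rep; case: arg_minnP => // j /eqP fj jmin; split => // k fk.
  by apply: jmin; rewrite fk.
have repE i j : f i = f j -> rep i = rep j.
  have [fi mi] := repP i; have [fj mj] := repP j => fij.
  by apply/val_inj/eqP; rewrite eqn_leq mi ?mj// ?fi ?fj.
pose J : pred 'I_n := [pred i | rep i == i].
exists (enum J); split; first exact: enum_uniq.
  by move=> i j; rewrite !mem_enum !inE => /eqP <- /eqP <-; have [-> _] := repP i;
    have [-> _] := repP j; exact: repE.
rewrite -cardE mulnC -sum_nat_const -[leqLHS]card_ord -sum1_card.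
rewrite (partition_big rep J)/=; last first.
  by move=> i _; apply/eqP; apply: repE; have [] := repP i.
apply: leq_sum => j _.
rewrite sum1_card; apply: leq_trans (HM j); apply: subset_leq_card.
apply/fintype.subsetP => i ij; have /eqP <- : rep i == j by exact: ij.
by rewrite inE; have [-> _] := repP i.
Qed.

Lemma exists_large_term {R : realType} {T : eqType} (L : seq T) (f : T -> R) (M : nat) x :
  0 < x -> x <= \sum_(u <- L) f u -> (size L <= M)%N ->
  exists2 u, u \in L & x <= M%:R * f u.
Proof.
move=> x0 xs sL; apply: contrapT => no.
have lt u : u \in L -> M%:R * f u < x.
  by move=> uL; rewrite ltNge; apply/negP => h; apply: no; exists u.
have M0 : (0 < M)%N.
  case: (L) xs sL => [|u L' _]; first by rewrite big_nil leNgt x0.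
  exact: leq_trans.
have : M%:R * x <= \sum_(u <- L) M%:R * f u.
  by rewrite -mulr_sumr ler_pM2l// ltr0n.
have L0 : L != [::].
  by case: (L) xs => [|//]; rewrite big_nil leNgt x0.
apply/negP; rewrite -ltNge; apply: (@lt_le_trans _ _ (\sum_(u <- L) x)).
  rewrite big_seq [ltRHS]big_seq; apply: ltr_sum => //.
  by apply/hasP; case: (L) L0 => // u L' _; exists u; rewrite mem_head.
by rewrite big_const_seq count_predT iter_addr addr0 -[leLHS]mulr_natl ler_pM2r// ler_nat.
Qed.

(** Consider the first index at which [g] is at most [a]. *)
Lemma discrete_ivt {R : realType} (g : nat -> R) (m : nat) (a K : R) :
  0 <= a -> 0 <= K -> - a <= g 0%N -> g m <= a ->
  (forall k, (k < m)%N -> `|g k.+1 - g k| <= K) ->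
  exists2 k, (k <= m)%N & `|g k| <= a + K.
Proof.
move=> a0 K0 g0 gm st.
have ex : exists k, g k <= a by exists m.
case: (ex_minnP ex) => k gk kmin; have km : (k <= m)%N by exact: kmin.
exists k => //; rewrite ler_norml; apply/andP; split; last by lra.
case: k gk kmin km => [|k] gk kmin km; first by lra.
have gk' : a < g k by rewrite ltNge; apply/negP => /kmin; rewrite ltnn.
by have := st k km; rewrite ler_norml => /andP[h _]; lra.
Qed.

Lemma exp_beats_linear {R : realType} (theta C : R) (m0 : nat) : 0 < theta ->
  exists2 m, (m0 < m)%N & m.+1%:R * C < expR (m%:R * theta).
Proof.
move=> th0.
have [n n0 Hn] := exists_nat_mul_ge (4 * `|C| / theta) _ th0.
pose m := (m0 + n).+1; exists m; first by rewrite ltnS leq_addr.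
have {}Hn := Hn m (leqW (leq_addl _ _)).
have m1 : 1 <= m%:R :> R by rewrite ler1n.
have mt0 : 0 <= m%:R * theta by rewrite mulr_ge0// ltW.
apply: (@lt_le_trans _ _ (1 + (m%:R * theta) ^+ 2 / 2`!%:R)); last exact: expR_ge1Dxn.
have h : 4 * `|C| <= m%:R * theta ^+ 2.
  by move: Hn; rewrite ler_pdivrMr// -mulrA -expr2.
have : m%:R * (4 * `|C|) <= m%:R * (m%:R * theta ^+ 2) by rewrite ler_wpM2l.
have -> : (m%:R * theta) ^+ 2 / 2`!%:R = m%:R * (m%:R * theta ^+ 2) / 2.
  by rewrite exprMn expr2 mulrA.
have : m.+1%:R * C <= m.+1%:R * `|C| by rewrite ler_wpM2l// ler_norm.
have : m.+1%:R * `|C| <= 2 * m%:R * `|C|.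
  by rewrite ler_wpM2r// -natr1; lra.
by lra.
Qed.

Lemma summable_list_bound {R : realType} {T : choiceType} (D : set T) (f : T -> R) :
  (forall x, 0 <= f x) -> summable D (fun x => (f x)%:E) ->
  exists Z : R, forall L : seq T, uniq L -> {in L, forall x, D x} ->
    \sum_(x <- L) f x <= Z.
Proof.
move=> f0 sm; have sm' : (\esum_(x in D) `|(f x)%:E| < +oo)%E := sm.
have e0 : (0 <= \esum_(x in D) `|(f x)%:E|)%E by exact: esum_ge0.
exists (fine (\esum_(x in D) `|(f x)%:E|)%E) => L uL LD.
rewrite -lee_fin fineK ?ge0_fin_numE//; apply: esum_ge.
exists [set` L]; first by split => // x /= /LD.
rewrite -sumEFin (eq_bigr (fun x => `|(f x)%:E|%E)).
  by rewrite fsbig_seq.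
by move=> x _; rewrite gee0_abs// lee_fin.
Qed.

Section MixingWords.
Context {R : realType} {N : nat} {r p : 'I_N.+1 -> R}.
Context (r01 : forall i, 0 < r i < 1) (p_gt0 : forall i, 0 < p i).
Local Notation rw := (word_prod r).
Local Notation pw := (word_prod p).
Local Notation word := (seq 'I_N.+1).

(** Out of words [u i] of excess at most [eta] and words [w i] of excess at least
    [- eta], every list [c] of [m] indices yields a concatenation
    [u c_0 .. u c_(k-1) w c_k .. w c_(m-1)] of small total excess, where [k] comes
    from a discrete intermediate value argument; [l] copies of the letter [j]
    then move the exponent into [I].  For a fixed [k] different lists give
    different words, so each of the [m.+1] values of [k] accounts for at most the
    value [Z] of the zeta function. *)
Lemma mixed_words_bound (I : set R) (alpha e kappa t Z : R) (j : 'I_N.+1) :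
  `|e| = 1 -> 0 < e * excess r p alpha [:: j] ->
  (forall w, w != [::] -> 0 <= e * excess r p alpha w <= kappa * depth r w ->
      I (ln (pw w) / ln (rw w))) ->
  (forall L : seq word, uniq L -> {in L, forall w, zeta_words r p I w} ->
    \sum_(w <- L) rw w `^ t <= Z) ->
  forall (T : eqType) (J : seq T) (u w : T -> word) (b eta K D1 D2 : R),
  uniq J -> {in J &, injective u} -> {in J &, injective w} ->
  {in J, forall i, [/\ stops r b (u i), D1 <= depth r (u i) <= D2,
     excess r p alpha (u i) <= eta & `|excess r p alpha (u i)| <= K]} ->
  {in J, forall i, [/\ stops r b (w i), D1 <= depth r (w i) <= D2,
     - eta <= excess r p alpha (w i) & `|excess r p alpha (w i)| <= K]} ->
  0 < D1 -> 0 <= eta -> 0 <= K ->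
  forall (m l : nat) (tau : R), (0 < m)%N ->
  m%:R * eta + 2 * K <= l%:R * (e * excess r p alpha [:: j]) ->
  l%:R * (e * excess r p alpha [:: j]) + (m%:R * eta + 2 * K)
    <= kappa * (m%:R * D1) -> 0 <= kappa ->
  (forall y, m%:R * D1 <= y <= m%:R * D2 + l%:R * depth r [:: j] -> t * y <= tau) ->
  (size J)%:R ^+ m <= m.+1%:R * Z * expR tau.
Proof.
move=> e1 ej HI HZ T J u w b eta K D1 D2 uJ uinj winj Hu Hw D10 eta0 K0.
move=> m l tau m0 Hl1 Hl2 kappa0 Htau.
have [->|J0] := eqVneq J [::].
  rewrite /= expr0n gtn_eqF//= mulr_ge0 ?expR_ge0// mulr_ge0//.
  by have := HZ [::] isT; rewrite big_nil; apply.
have [x0 _] : exists x0, x0 \in J.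
  by case: (J) J0 => // x0 J' _; exists x0; rewrite mem_head.
(* Entries of [c] before position [k] use [u], the others [w]. *)
pose path k c := [seq u i | i <- take k c] ++ [seq w i | i <- drop k c].
pose full k c := flatten (path k c) ++ nseq l j.
pose ex (v : word) := excess r p alpha v.
have ex_path k c : ex (flatten (path k c)) =
    \sum_(i <- take k c) ex (u i) + \sum_(i <- drop k c) ex (w i).
  by rewrite /ex excess_flatten// /path big_cat/= !big_map.
have const_sum (L : seq T) (a : R) : \sum_(i <- L) a = (size L)%:R * a.
  by rewrite big_const_seq count_predT iter_addr addr0 mulr_natl.
have path_in k c v : {subset c <= J} -> v \in path k c ->
    stops r b v /\ D1 <= depth r v <= D2.
  move=> cJ; rewrite mem_cat => /orP[] /mapP[i ic ->].
    by have [] // := Hu i _; apply: cJ; exact: mem_take ic.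
  by have [] // := Hw i _; apply: cJ; exact: mem_drop ic.
have size_path k c : size (path k c) = size c.
  by rewrite size_cat !size_map -size_cat cat_take_drop.
have choose_k c : exists k : 'I_m.+1, c \in all_lists J m ->
    `|ex (flatten (path k c))| <= m%:R * eta + 2 * K.
  have [/mem_all_lists[sc cJ]|_] := boolP (c \in all_lists J m); last by exists ord0.
  have me0 : 0 <= m%:R * eta by rewrite mulr_ge0.
  have [k km Hk] : exists2 k, (k <= m)%N &
      `|ex (flatten (path k c))| <= m%:R * eta + 2 * K.
    apply: discrete_ivt => //.
    - by rewrite mulr_ge0.
    - rewrite ex_path take0 big_nil add0r drop0 -mulrN -sc -const_sum.
      rewrite big_seq [leRHS]big_seq; apply: ler_sum => i /cJ iJ.
      by have [] := Hw i iJ.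
    - rewrite ex_path take_oversize ?sc// drop_oversize ?sc// big_nil addr0 -sc -const_sum.
      rewrite big_seq [leRHS]big_seq; apply: ler_sum => i /cJ iJ.
      by have [] := Hu i iJ.
    - move=> k km; rewrite !ex_path (take_nth x0) ?sc// (drop_nth x0 (n := k)) ?sc//.
      rewrite -cats1 big_cat/= big_seq1 big_cons.
      have iJ : nth x0 c k \in J by apply/cJ/mem_nth; rewrite sc.
      have [_ _ _ hu] := Hu _ iJ; have [_ _ _ hw] := Hw _ iJ.
      rewrite (_ : _ - _ = ex (u (nth x0 c k)) - ex (w (nth x0 c k))); last by ring.
      by apply: le_trans (ler_normB _ _) _; rewrite /ex; lra.
  by exists (Ordinal (km : (k < m.+1)%N)).
have [kc Hkc] := choice choose_k.
have depth_full k c : {subset c <= J} -> size c = m ->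
    m%:R * D1 <= depth r (full k c) <= m%:R * D2 + l%:R * depth r [:: j].
  move=> cJ sc; rewrite /full depth_cat// depth_nseq// depth_flatten//.
  have sp : size (path k c) = m by rewrite size_path.
  have dn : 0 <= l%:R * depth r [:: j] by rewrite mulr_ge0// depth_ge0.
  have cs (a : R) : m%:R * a = \sum_(v <- path k c) a.
    by rewrite big_const_seq count_predT iter_addr addr0 sp mulr_natl.
  apply/andP; split.
    apply: ler_wpDr => //; rewrite cs big_seq [leRHS]big_seq.
    by apply: ler_sum => v /(path_in _ _ _ cJ)[_ /andP[]].
  rewrite lerD2r cs big_seq [leRHS]big_seq.
  by apply: ler_sum => v /(path_in _ _ _ cJ)[_ /andP[]].
have mD1 : 0 < m%:R * D1 by rewrite mulr_gt0// ltr0n.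
have full_zeta c : c \in all_lists J m -> zeta_words r p I (full (kc c) c).
  move=> cA; have [sc cJ] := mem_all_lists _ _ _ cA.
  have /andP[d1 d2] := depth_full (kc c) c cJ sc.
  have fn : full (kc c) c != [::].
    by apply/eqP => f0; move: d1; rewrite f0 depth_nil leNgt mD1.
  split => //; apply: HI => //.
  rewrite /full excess_cat// excess_nseq// mulrDr mulrCA.
  have : `|e * ex (flatten (path (kc c) c))| <= m%:R * eta + 2 * K.
    by rewrite normrM e1 mul1r; exact: Hkc.
  rewrite ler_norml => /andP[h1 h2].
  have : kappa * (m%:R * D1) <= kappa * depth r (full (kc c) c) by rewrite ler_wpM2l.
  by rewrite /full in d1 d2 *; move: h1 h2; rewrite /ex => h1 h2 h3; apply/andP; lra.
have full_inj k c c' : c \in all_lists J m -> c' \in all_lists J m ->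
    full k c = full k c' -> c = c'.
  move=> /mem_all_lists[sc cJ] /mem_all_lists[sc' c'J] E.
  have : path k c = path k c'.
    apply: (prefix_free_flatten_inj (stops r b) _ _ _ _ _ _ _ _ E).
    - exact: (stops_prefix r01 b).
    - by move=> v /(path_in _ _ _ cJ)[].
    - by move=> v /(path_in _ _ _ c'J)[].
    - by rewrite !size_path sc sc'.
  move/eqP; rewrite eqseq_cat; last by rewrite !size_map !size_take sc sc'.
  move=> /andP[/eqP h1 /eqP h2].
  rewrite -(cat_take_drop k c) -(cat_take_drop k c'); congr (_ ++ _).
    by apply: (inj_in_map uinj) h1; apply/allP => i /mem_take; [move/cJ|move/c'J].
  by apply: (inj_in_map winj) h2; apply/allP => i /mem_drop; [move/cJ|move/c'J].
rewrite -ler_pdivrMr ?expR_gt0// -expRN.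
apply: (@le_trans _ _ (\sum_(c <- all_lists J m) rw (full (kc c) c) `^ t)).
  have -> : (size J)%:R ^+ m * expR (- tau) = \sum_(c <- all_lists J m) expR (- tau).
    rewrite big_const_seq count_predT iter_addr addr0 size_all_lists -[RHS]mulr_natl.
    by rewrite natrX.
  rewrite big_seq [leRHS]big_seq; apply: ler_sum => c /mem_all_lists[sc cJ].
  by rewrite powR_rw// ler_expR lerN2; apply/Htau/depth_full.
rewrite (partition_big kc predT)//=.
apply: (@le_trans _ _ (\sum_(k < m.+1) Z)); last by rewrite sumr_const card_ord mulr_natl.
apply: ler_sum => k _; rewrite -big_filter.
have uF : uniq [seq c <- all_lists J m | kc c == k].
  by rewrite filter_uniq// all_lists_uniq.
rewrite (eq_big_seq (fun c => rw (full k c) `^ t)); last first.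
  by move=> c; rewrite mem_filter => /andP[/eqP->].
rewrite -(big_map (full k) predT (fun v => rw v `^ t)); apply: HZ.
  rewrite map_inj_in_uniq// => c c'; rewrite !mem_filter => /andP[_ cA] /andP[_ c'A].
  exact: full_inj.
move=> v /mapP[c]; rewrite mem_filter => /andP[/eqP <- cA] ->.
exact: full_zeta.
Qed.

End MixingWords.

(** * The coarse spectrum is at most the abscissa *)

Section Estimates.
Context {R : realFieldType}.
Implicit Types D q y z alpha rho t kappa eta : R.

Lemma lt_summands (y1 y2 y3 y : R) : 0 <= y1 -> 0 <= y2 -> 0 <= y3 ->
  y1 + y2 + y3 < y -> [/\ 0 < y, y1 < y, y2 < y & y3 < y].
Proof. by move=> *; split; lra. Qed.

Lemma half_lt_shift D q : 2 * `|q| < D -> - D <= q /\ D / 2 < D + q.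
Proof. by have := ler_norm q; have := ler_norm (- q); rewrite normrN; split; lra. Qed.

Lemma dist_shift_le D q (w y : R) : 0 <= w -> D + q <= y <= D + q + w ->
  `|y - D| <= `|q| + w.
Proof.
have := ler_norm q; have := ler_norm (- q); rewrite normrN ler_norml.
by move=> q1 q2 w0 /andP[y1 y2]; apply/andP; lra.
Qed.

Lemma excess_upper_estimate alpha rho D (a b y z h : R) :
  a + b <= rho * D -> `|alpha * (h - D)| <= b ->
  y <= (alpha + rho) * D -> - z <= y + a -> alpha * - h - z <= 2 * (rho * D).
Proof. by rewrite ler_norml mulrDl mulrBr mulrN => ab /andP[]; lra. Qed.

Lemma excess_lower_estimate alpha rho D (a b y z h : R) : 0 <= a ->
  a + b <= rho * D -> `|alpha * (h - D)| <= b ->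
  (alpha - rho) * D <= y -> y <= - z -> - (2 * (rho * D)) <= alpha * - h - z.
Proof. by rewrite ler_norml mulrBl mulrBr mulrN => a0 ab /andP[]; lra. Qed.

Lemma growth_rate_gt0 t D q (s a w y : R) : 0 <= a -> 0 < (s - t) * D ->
  2 * (a + `|t| * (`|q| + w)) < (s - t) * D -> y <= (s - t) * D / 4 ->
  0 < s * D - a - (t * (D + q) + `|t| * w + y).
Proof.
have : t * q <= `|t| * `|q| by rewrite -normrM ler_norm.
have -> : s * D = t * D + (s - t) * D by ring.
rewrite !mulrDr; move: ((s - t) * D) (`|t| * `|q|) (`|t| * w) => *; lra.
Qed.

Lemma steering_room kappa rho D q : 0 < D -> 0 < kappa -> 16 * rho <= kappa ->
  D / 2 < D + q -> 0 < kappa * (D + q) - 2 * (2 * (rho * D)).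
Proof.
move=> D0 k0 rk h; have k1 : kappa * (D / 2) < kappa * (D + q) by rewrite ltr_pM2l.
have k2 : 16 * rho * D <= kappa * D by rewrite ler_pM2r.
have k3 : 0 < kappa * D by rewrite mulr_gt0.
lra.
Qed.

Lemma steering_fits kappa eta (m D K c x : R) :
  4 * K + c <= m * (kappa * D - 2 * eta) -> x <= m * eta + 2 * K + c ->
  x + (m * eta + 2 * K) <= kappa * (m * D).
Proof. rewrite mulrBr (mulrCA kappa); lra. Qed.

End Estimates.

Section CoarseUpper.
Context {R : realType} {d N : nat}.
Context {S : 'I_N.+1 -> 'rV[R]_d.+1 -> 'rV[R]_d.+1} {r p : 'I_N.+1 -> R}.
Context (r01 : forall i, 0 < r i < 1).
Context (S_sim : forall i, similarity (r i) (S i)).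
Context (p_gt0 : forall i, 0 < p i) (p_sum : \sum_i p i = 1).
Context {mu : probability (borelRd R d.+1) R}.
Context (mu_ss : self_similar_measure mu p S) (S_osc : open_set_condition S).
Local Notation rw := (word_prod r).
Local Notation pw := (word_prod p).
Local Notation word := (seq 'I_N.+1).

Let r_gt0 i : 0 < r i. Proof. by have /andP[] := r01 i. Qed.
Let rw_gt0 w : 0 < rw w. Proof. exact: word_prod_gt0. Qed.
Let pw_gt0 w : 0 < pw w. Proof. exact: word_prod_gt0. Qed.

(** The mass of a ball is at least that of a small cylinder inside it and at most
    a constant times that of one of the boundedly many cylinders of comparable
    size that meet it. *)
Lemma packing_words (Q : R) : 0 < Q -> mu (eball 0 Q) = 1%E ->
  exists2 M : nat, (0 < M)%N & forall (e : R) n (x : 'I_n -> 'rV[R]_d.+1),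
    0 < e <= 4 * Q -> (forall i, measure_support mu (x i)) ->
    (forall i j, i != j -> eball (x i) e `&` eball (x j) e = set0) ->
    exists u w : 'I_n -> word,
    [/\ forall i, stops r (e / (4 * Q)) (u i), forall i, stops r (e / (4 * Q)) (w i),
      injective w, forall i, pw (w i) <= fine (mu (eball (x i) e)) &
      (forall i, fine (mu (eball (x i) e)) <= M%:R * pw (u i)) /\
      forall i0, (#|[pred i | u i == u i0]| <= M)%N].
Proof.
move=> Q0 muQ; have Q90 : 0 <= 9 * Q by rewrite mulr_ge0// ltW.
have [M HM] := osc_bounded_overlap r01 S_sim _ _ S_osc (rmin_gt0 r01) Q90.
exists M.+1 => // e n x /andP[e0 eQ] sx dx.
have Q40 : 0 < 4 * Q by rewrite mulr_gt0.
set b := e / (4 * Q).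
have b0 : 0 < b by rewrite divr_gt0.
have b1 : b <= 1 by rewrite ler_pdivrMr// mul1r.
have eE : e = 4 * Q * b by rewrite /b; field; rewrite gt_eqF.
have [n0 nb] := stopseq_fuel r01 _ b0.
have HMb (y : 'rV[R]_d.+1) (L : seq word) : uniq L -> {in L, forall v, stops r b v} ->
    {in L, forall v, edist (word_map S v 0) y <= 9 * Q * b} -> (size L <= M)%N.
  move=> uL sL nL; apply: (HM b y) => //.
    by move=> v v' /sL h /sL h'; exact: (stops_prefix r01 _ _ _ h h').
  move=> v /sL h; rewrite (stops_lb r01)//=; by case: h.
have center v : cyl S r Q v (word_map S v 0).
  by rewrite /cyl /eball /= edistxx mulr_ge0// ltW.
have Hw i : exists w, stops r b w /\ cyl S r Q w `<=` eball (x i) e.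
  have [|w wG wB] := exists_cyl_in_ball r01 S_sim p_gt0 mu_ss Q0 muQ n0 b (x i) e
    (sx i) b0 nb; first by rewrite eE.
  by exists w; split => //; exact: stopseq_stops r01 _ _ _ b0 nb wG.
have [w {}Hw] := choice Hw.
have near_ball i v : stops r b v -> (cyl S r Q v `&` eball (x i) e) !=set0 ->
    edist (word_map S v 0) (x i) <= 5 * Q * b.
  move=> [vb _] [y [vy xy]]; move: vy xy; rewrite /cyl /eball /= => vy xy.
  have := edist_triangle y (word_map S v 0) (x i); rewrite (edistC y (x i)).
  have : rw v * Q <= b * Q by rewrite ler_pM2r.
  by move: xy; rewrite eE (mulrC b Q) -!mulrA => *; lra.
have Hu i : exists u, [/\ stops r b u, (cyl S r Q u `&` eball (x i) e) !=set0 &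
    fine (mu (eball (x i) e)) <= M.+1%:R * pw u].
  have mpos := mu_eball_gt0 (x i) _ (sx i) e0.
  have := mu_le_meeting r01 S_sim p_gt0 mu_ss muQ n0 b _ (closed_eball (x i) e).
  rewrite -big_filter => mle.
  have LP v : v \in [seq u <- stopseq r n0 b | `[< cyl S r Q u `&` eball (x i) e !=set0 >]] ->
      stops r b v /\ (cyl S r Q v `&` eball (x i) e) !=set0.
    rewrite mem_filter => /andP[/asboolP h vG]; split => //.
    exact: stopseq_stops r01 _ _ _ b0 nb vG.
  have [|u /LP[su mu'] hu] := exists_large_term _ _ M _ mpos mle.
    apply: (HMb (x i)); first by rewrite filter_uniq// stopseq_uniq.
      by move=> v /LP[].
    move=> v /LP[sv mv]; apply: le_trans (near_ball i v sv mv) _.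
    by have := mulr_gt0 Q0 b0; rewrite -!mulrA; lra.
  exists u; split => //; apply: le_trans hu _.
  by rewrite ler_pM2r// ler_nat.
have [u {}Hu] := choice Hu.
have wB i : eball (x i) e (word_map S (w i) 0) by have [_] := Hw i; apply.
have winj : injective w.
  move=> i i' ww; apply/eqP; apply: contraT => /dx/seteqP[h _].
  by exfalso; apply: (h (word_map S (w i) 0)); split => //; rewrite ww.
exists u, w; split => //.
- by move=> i; have [] := Hu i.
- by move=> i; have [] := Hw i.
- move=> i; have [_ h] := Hw i.
  exact: (mu_ge_cyl r01 S_sim p_gt0 mu_ss muQ _ _ (closed_eball _ _) h).
split; first by move=> i; have [] := Hu i.
move=> i0; apply: leqW; rewrite cardE -(size_map w).
apply: (HMb (word_map S (u i0) 0)); first by rewrite map_inj_uniq ?enum_uniq.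
  by move=> _ /mapP[i _ ->]; have [] := Hw i.
move=> _ /mapP[i + ->]; rewrite mem_enum inE => /eqP uu.
have [su mui _] := Hu i; have := near_ball i (u i) su mui; rewrite uu.
have := edist_triangle (x i) (word_map S (w i) 0) (word_map S (u i0) 0).
have := wB i; rewrite /eball /= (edistC (x i) (word_map S (w i) 0)) eE.
rewrite (edistC (x i) (word_map S (u i0) 0)) -!mulrA; lra.
Qed.

(** A packing by more than [expR (s * - ln del)] balls of radius [del] and
    exponents close to [alpha] gives, at this single scale, enough words to make
    the zeta function diverge at [t < s]: the number of concatenations of [m] of
    them grows exponentially faster than the bound for mixed words. *)
Lemma packing_count_le (I : set R) (alpha e kappa s t Z rho Q del : R) (M : nat)
    (j : 'I_N.+1) :
  `|e| = 1 -> 0 < e * excess r p alpha [:: j] ->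
  (forall w, w != [::] -> 0 <= e * excess r p alpha w <= kappa * depth r w ->
      I (ln (pw w) / ln (rw w))) ->
  (forall L : seq word, uniq L -> {in L, forall w, zeta_words r p I w} ->
    \sum_(w <- L) rw w `^ t <= Z) ->
  0 < Q -> (0 < M)%N ->
  (forall (e : R) n (x : 'I_n -> 'rV[R]_d.+1),
    0 < e <= 4 * Q -> (forall i, measure_support mu (x i)) ->
    (forall i j, i != j -> eball (x i) e `&` eball (x j) e = set0) ->
    exists u w : 'I_n -> word,
    [/\ forall i, stops r (e / (4 * Q)) (u i), forall i, stops r (e / (4 * Q)) (w i),
      injective w, forall i, pw (w i) <= fine (mu (eball (x i) e)) &
      (forall i, fine (mu (eball (x i) e)) <= M%:R * pw (u i)) /\
      forall i0, (#|[pred i | u i == u i0]| <= M)%N]) ->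
  t < s -> 0 < kappa -> 0 < rho -> 16 * rho <= kappa ->
  8 * (`|t| * rho * depth r [:: j]) <= (s - t) * (e * excess r p alpha [:: j]) ->
  0 < del ->
  2 * `|ln (4 * Q)| + (ln M%:R + `|alpha| * (`|ln (4 * Q)| - ln (rmin r))) / rho
      + 2 * (ln M%:R + `|t| * (`|ln (4 * Q)| - ln (rmin r))) / (s - t) < - ln del ->
  forall n (x : 'I_n -> 'rV[R]_d.+1), packing_family mu alpha rho del x ->
    n%:R <= expR (s * - ln del).
Proof.
move=> e1 ej HI HZ Q0 M0 HM ts kappa0 rho0 rho1 rho2 del0.
have [D DE] : {y : R | y = - ln del} by exists (- ln del).
have [q4 q4E] : {y | y = ln (4 * Q)} by exists (ln (4 * Q)).
have [cr crE] : {y | y = - ln (rmin r)} by exists (- ln (rmin r)).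
have [lM lME] : {y : R | y = ln M%:R} by exists (ln M%:R).
have [c cE] : {y | y = e * excess r p alpha [:: j]} by exists (e * excess r p alpha [:: j]).
have [bj bjE] : {y | y = depth r [:: j]} by exists (depth r [:: j]).
rewrite -DE -q4E -crE -lME => Dbig n x [sx dx rx].
rewrite -cE -bjE in ej rho2.
have bj0 : 0 < bj by rewrite bjE depth_gt0.
have st0 : 0 < s - t by rewrite subr_gt0.
have cr0 : 0 <= cr.
  rewrite crE oppr_ge0 ln_le0//; apply: le_trans (rmin_le r01 ord0) _.
  by have /andP[_ /ltW] := r01 ord0.
have lM0 : 0 <= lM by rewrite lME ln_ge0// ler1n.
have q40 : 0 <= `|q4| by [].
have C10 : 0 <= `|q4| + cr by rewrite addr_ge0.
have aC0 : 0 <= `|alpha| * (`|q4| + cr) by rewrite mulr_ge0.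
have tC0 : 0 <= `|t| * (`|q4| + cr) by rewrite mulr_ge0.
have [D0 Dq Drho DC4] : [/\ 0 < D, 2 * `|q4| < D,
    lM + `|alpha| * (`|q4| + cr) <= rho * D &
    2 * (lM + `|t| * (`|q4| + cr)) < (s - t) * D].
  have [|||-> -> h2 h3] := lt_summands _ _ _ _ _ _ _ Dbig.
  - by rewrite mulr_ge0.
  - by rewrite divr_ge0 ?addr_ge0// ltW.
  - by rewrite divr_ge0 ?(ltW st0)// mulr_ge0// addr_ge0.
  split=> //; first by rewrite [rho * D]mulrC -ler_pdivrMr// ltW.
  by rewrite [(s - t) * D]mulrC -ltr_pdivrMr.
have [Dq4 D1h] := half_lt_shift _ _ Dq.
have Q40 : 0 < 4 * Q by rewrite mulr_gt0.
have delQ : del <= 4 * Q.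
  by rewrite -ler_ln ?posrE// -q4E -[ln del]opprK -DE.
set b := del / (4 * Q).
have b0 : 0 < b by rewrite divr_gt0.
have b1 : b <= 1 by rewrite ler_pdivrMr// mul1r.
have lnb : - ln b = D + q4 by rewrite /b ln_div ?posrE// DE q4E opprB addrC.
have depthD v : stops r b v -> D + q4 <= depth r v <= D + q4 + cr.
  move=> sv; have := stops_lb r01 _ _ b0 b1 sv; case: sv => vb _ bv.
  rewrite -lnb /depth; apply/andP; split; first by rewrite lerN2 ler_ln ?posrE.
  have rm0 := rmin_gt0 r01; have rb0 : 0 < rmin r * b by exact: mulr_gt0.
  have -> : - ln b + cr = - ln (rmin r * b).
    by rewrite lnM ?posrE// crE -opprD addrC.
  by rewrite lerN2 ler_ln ?posrE.
have alpha_depth v : stops r b v ->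
    `|alpha * (depth r v - D)| <= `|alpha| * (`|q4| + cr).
  move=> /depthD h; rewrite normrM ler_wpM2l//; exact: dist_shift_le h.
rewrite leNgt; apply/negP => ns.
have [u [w [su sw winj wmu [umu ufib]]]] := HM del n x (introT andP (conj del0 delQ)) sx dx.
have [J [uJ uinj nJ]] := exists_fiber_representatives _ _ _ ufib.
have mpos i := mu_eball_gt0 (x i) _ (sx i) del0.
have massD i : (alpha - rho) * D <= - ln (fine (mu (eball (x i) del))) <= (alpha + rho) * D.
  have := rx i; rewrite /log_ratio -[ln del]opprK -DE invrN mulrN -mulNr.
  by rewrite ler_pdivlMr// ler_pdivrMr.
have exu i : excess r p alpha (u i) <= 2 * (rho * D).
  have /andP[_ m2] := massD i.
  rewrite /excess -[ln (rw _)]opprK -/(depth r (u i)).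
  apply: (excess_upper_estimate _ _ _ _ _ _ _ _ Drho (alpha_depth _ (su i)) m2).
  rewrite lerNl opprD opprK lerBlDr lME -lnM ?posrE ?ltr0n//.
  by rewrite ler_ln ?posrE ?mulr_gt0 ?ltr0n// mulrC.
have exw i : - (2 * (rho * D)) <= excess r p alpha (w i).
  have /andP[m1 _] := massD i.
  rewrite /excess -[ln (rw _)]opprK -/(depth r (w i)).
  apply: (excess_lower_estimate _ _ _ _ _ _ _ _ lM0 Drho (alpha_depth _ (sw i)) m1).
  by rewrite lerN2 ler_ln ?posrE.
have [eta etaE] : {y | y = 2 * (rho * D)} by exists (2 * (rho * D)).
rewrite -etaE in exu exw.
have eta0 : 0 <= eta by rewrite etaE !mulr_ge0// ltW.
(* A bound depending on the packing is enough, since the number [m] of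
   concatenated words grows while the packing stays fixed. *)
have [K KE] : {K | K = \sum_i (`|excess r p alpha (u i)| + `|excess r p alpha (w i)|)}.
  by eexists.
have KP i : `|excess r p alpha (u i)| + `|excess r p alpha (w i)| <= K.
  by rewrite KE (bigD1 i)//= lerDl sumr_ge0// => k _; rewrite addr_ge0.
have K0 : 0 <= K by rewrite KE; apply: sumr_ge0 => i _; rewrite addr_ge0.
have KPu i : `|excess r p alpha (u i)| <= K.
  by apply: le_trans (KP i); rewrite lerDl.
have KPw i : `|excess r p alpha (w i)| <= K.
  by apply: le_trans (KP i); rewrite lerDr.
(* [a] is the linear rate in [m] of the exponent [tau] below, [C3] its constant
   part. *)
have [a aE] : {a | a = t * (D + q4) + `|t| * cr + `|t| * (eta / c * bj)} by eexists.
have [C3 C3E] : {y | y = `|t| * ((2 * K / c + 1) * bj)} by eexists.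
have theta0 : 0 < s * D - lM - a.
  have e1' : `|t| * (eta / c * bj) <= (s - t) * D / 4.
    have -> : `|t| * (eta / c * bj) = 8 * (`|t| * rho * bj) * (D / (4 * c)).
      by rewrite etaE; field; rewrite gt_eqF.
    have -> : (s - t) * D / 4 = (s - t) * c * (D / (4 * c)).
      by field; rewrite gt_eqF.
    by rewrite ler_wpM2r// divr_ge0 ?mulr_ge0// ltW.
  by rewrite aE; apply: growth_rate_gt0 => //; exact: mulr_gt0.
have kD : 0 < kappa * (D + q4) - 2 * eta by rewrite etaE; exact: steering_room.
have [m0 _ Hm0] := exists_nat_mul_ge (4 * K + c) _ kD.
have [m mm Hm] := exp_beats_linear _ (Z * expR C3) m0 theta0.
have {}Hm0 := Hm0 m (ltnW mm).
have m_gt0 : (0 < m)%N by exact: leq_ltn_trans mm.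
have [A AE] : {A | A = m%:R * eta + 2 * K} by eexists.
have A0 : 0 <= A by rewrite AE addr_ge0 ?mulr_ge0.
pose l := (Num.truncn (A / c)).+1.
have lc1 : A <= l%:R * c.
  by rewrite -ler_pdivrMr//; apply/ltW; exact: truncnS_gt.
have lc2 : l%:R <= A / c + 1.
  by rewrite -natr1 lerD2r truncn_le divr_ge0// ltW.
have lc3 : l%:R * c <= A + c.
  apply: le_trans (ler_wpM2r (ltW ej) lc2) _.
  by rewrite mulrDl mul1r divfK ?gt_eqF.
(* An upper bound for [t] times the depth of a mixed word for either sign of
   [t]. *)
pose tau := t * (m%:R * (D + q4)) + `|t| * (m%:R * cr + l%:R * bj).
have D10 : 0 < D + q4 by apply: lt_trans D1h; rewrite divr_gt0.
have lc4 : l%:R * c + (m%:R * eta + 2 * K) <= kappa * (m%:R * (D + q4)).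
  by apply: steering_fits Hm0 _; rewrite -AE.
have main : (size J)%:R ^+ m <= m.+1%:R * Z * expR tau.
  have ej' : 0 < e * excess r p alpha [:: j] by rewrite -cE.
  apply: (mixed_words_bound r01 p_gt0 I alpha e kappa t Z j e1 ej' HI HZ _ J u w b
    eta K (D + q4) (D + q4 + cr) uJ uinj _ _ _ D10 eta0 K0 m l tau m_gt0).
  - by move=> i i' _ _; exact: winj.
  - by move=> i _; split => //; exact: depthD.
  - by move=> i _; split => //; exact: depthD.
  - by rewrite -cE -AE; exact: lc1.
  - by rewrite -cE; exact: lc4.
  - exact: ltW.
  - move=> y /andP[y1 y2]; rewrite -bjE in y2.
    have -> : t * y = t * (m%:R * (D + q4)) + t * (y - m%:R * (D + q4)) by ring.
    rewrite lerD2l; apply: le_trans (ler_norm _) _; rewrite normrM ler_wpM2l//.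
    rewrite ger0_norm ?subr_ge0// lerBlDr; apply: le_trans y2 _.
    by rewrite le_eqVlt; apply/orP; left; apply/eqP; ring.
have tau_le : tau <= m%:R * a + C3.
  have h : l%:R * bj <= (A / c + 1) * bj by rewrite ler_wpM2r// ltW.
  apply: (@le_trans _ _ (t * (m%:R * (D + q4)) + `|t| * (m%:R * cr + (A / c + 1) * bj))).
    by rewrite lerD2l ler_wpM2l// lerD2l.
  rewrite le_eqVlt; apply/orP; left; apply/eqP.
  by rewrite aE C3E AE; field; rewrite gt_eqF.
have sizeJ : expR (s * D - lM) <= (size J)%:R.
  have M0' : 0 < M%:R :> R by rewrite ltr0n.
  rewrite expRD expRN lME lnK ?posrE// ler_pdivrMr//.
  apply/ltW; apply: lt_le_trans ns _.
  by rewrite -natrM ler_nat mulnC.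
have Z0 : 0 <= Z by have := HZ [::] isT; rewrite big_nil; apply.
have : expR (s * D - lM) ^+ m <= m.+1%:R * Z * expR (m%:R * a + C3).
  apply: le_trans (le_trans main _); first by rewrite lerXn2r ?nnegrE ?expR_ge0.
  by rewrite ler_wpM2l ?mulr_ge0// ler_expR.
rewrite -expRM_natl => fin.
move: Hm; apply/negP; rewrite -leNgt.
have -> : m%:R * (s * D - lM - a) = m%:R * (s * D - lM) - m%:R * a by ring.
rewrite expRD expRN ler_pdivrMr ?expR_gt0//.
apply: le_trans fin _; rewrite expRD le_eqVlt; apply/orP; left; apply/eqP; ring.
Qed.

(** The tolerance [rho] is chosen so that the letters needed for steering cost
    less than the gap between [t] and [s]. *)
Lemma coarse_le_abscissa (I : set R) (alpha : R) : is_interval I ->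
  (interior I `&` `]min_over (fun i => ln (p i) / ln (r i)),
         max_over (fun i => ln (p i) / ln (r i))[) !=set0 -> I alpha ->
  (coarse_spectrum mu alpha <= abscissa_zeta_sim r p I)%E.
Proof.
move=> itvI meetsI Ialpha; apply: le_of_lt_real => s abs.
have [_ [t sumt <-]] := ereal_inf_lt abs; rewrite lte_fin => ts.
have [Z HZ] := summable_list_bound _ _ (fun w => powR_ge0 (rw w) t) sumt.
have [j [e [kappa [e1 kappa0 ej HI]]]] :=
  exists_steering_letter r01 _ _ itvI meetsI Ialpha.
have [Q [Q0 Qinv muQ]] := exists_invariant_ball r01 S_sim p_gt0 p_sum mu_ss.
have [M M0 HM] := packing_words _ Q0 muQ.
have bj0 : 0 < depth r [:: j] by exact: depth_gt0.
have st0 : 0 < s - t by rewrite subr_gt0.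
have den0 : 0 < 8 * (`|t| + 1) * depth r [:: j].
  by rewrite mulr_gt0// mulr_gt0// ltr_wpDl.
have [rho [rho0 rho1 rho2]] : exists rho, [/\ 0 < rho, 16 * rho <= kappa &
    8 * (`|t| * rho * depth r [:: j]) <= (s - t) * (e * excess r p alpha [:: j])].
  exists (Num.min (kappa / 16)
    ((s - t) * (e * excess r p alpha [:: j]) / (8 * (`|t| + 1) * depth r [:: j]))).
  set rho := Num.min _ _.
  have rho0 : 0 < rho.
    by rewrite lt_min divr_gt0//= divr_gt0//; exact: mulr_gt0.
  split=> //; first by rewrite mulrC -ler_pdivlMr// ge_min lexx.
  apply: (@le_trans _ _ (rho * (8 * (`|t| + 1) * depth r [:: j]))); last first.
    by rewrite -ler_pdivlMr// ge_min lexx orbT.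
  have -> : rho * (8 * (`|t| + 1) * depth r [:: j]) =
    8 * (`|t| * rho * depth r [:: j]) + 8 * (rho * depth r [:: j]) by ring.
  by rewrite lerDl !mulr_ge0// ltW.
apply: (coarse_spectrum_le _ _ _ _ rho0).
apply: limf_einf_le_near; near=> del.
have [_ D0] : 0 < del /\ 0 < - ln del by near: del; exact: near0_lt_neg_ln.
have [del0 Dbig] : 0 < del /\
    2 * `|ln (4 * Q)| + (ln M%:R + `|alpha| * (`|ln (4 * Q)| - ln (rmin r))) / rho
      + 2 * (ln M%:R + `|t| * (`|ln (4 * Q)| - ln (rmin r))) / (s - t) < - ln del.
  by near: del; exact: near0_lt_neg_ln.
apply: (@le_trans _ _ ((s * - ln del)%:E * ((- ln del)^-1)%:E)%E); last first.
  by rewrite -EFinM mulfK ?gt_eqF.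
apply: lee_wpmul2r; first by rewrite lee_fin invr_ge0 ltW.
rewrite -[s * _]expRK -lne_EFin ?expR_gt0//.
rewrite lee_lne ?in_itv/= ?leey ?packing_number_ge0 ?lee_fin ?expR_ge0//.
apply: ge_ereal_sup => _ [n [x px] <-]; rewrite lee_fin.
exact: (packing_count_le I alpha e kappa s t Z rho Q del M j) px.
Unshelve. all: by end_near.
Qed.

End CoarseUpper.

Theorem theorem1p2 (R : realType) (d N : nat)
    (S : 'I_N.+1 -> 'rV[R]_d.+1 -> 'rV[R]_d.+1) (r p : 'I_N.+1 -> R)
    (r_bounds : forall i, 0 < r i < 1)
    (S_sim : forall i, similarity (r i) (S i))
    (p_gt0 : forall i, 0 < p i) (p_sum : \sum_i p i = 1)
    (mu : probability (borelRd R d.+1) R)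
    (mu_self_similar : self_similar_measure mu p S)
    (S_osc : open_set_condition S)
    (I : set R) (I_itv : is_interval I) (I_closed : closed I)
    (I_meets : (interior I `&`
       `]min_over (fun i => ln (p i) / ln (r i)),
         max_over (fun i => ln (p i) / ln (r i))[) !=set0) :
  abscissa_zeta_sim r p I
    = ereal_sup [set multifractal_spectrum mu alpha | alpha in I]
  /\ ereal_sup [set multifractal_spectrum mu alpha | alpha in I]
    = ereal_sup [set coarse_spectrum mu alpha | alpha in I].
Proof.
have lower := abscissa_le_sup_spectrum r_bounds S_sim p_gt0 p_sum mu_self_similar S_osc
  I I_itv I_meets.
have middle : (ereal_sup [set multifractal_spectrum mu alpha | alpha in I]
    <= ereal_sup [set coarse_spectrum mu alpha | alpha in I])%E.
  apply: ge_ereal_sup => _ [alpha Ialpha <-].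
  apply: le_trans (multifractal_le_coarse mu alpha) _.
  by apply: ereal_sup_ubound; exists alpha.
have upper : (ereal_sup [set coarse_spectrum mu alpha | alpha in I]
    <= abscissa_zeta_sim r p I)%E.
  apply: ge_ereal_sup => _ [alpha Ialpha <-].
  exact: (coarse_le_abscissa r_bounds S_sim p_gt0 p_sum mu_self_similar S_osc).
split; apply/eqP; rewrite eq_le; apply/andP; split => //.
  exact: le_trans upper.
exact: le_trans lower.
Qed.
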